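(* OTVW restricted to instances $(G,\omega,\tau)$ in which $\tau(u)\in\left\{\sum_{e\in E(u,G)}\omega(e),\ \mu(G,\omega)\right\}$ for every $u\in V(G)$ can be solved in polynomial time.
   Context: An edge-weighted graph is a triple $(G,\omega,\tau)$ with $G=(V,E)$ a finite simple graph, $\omega:E\to[0,\infty)$ and $\tau:V\to[0,\infty)$. $E(u,G)$ is the set of edges incident to $u$, and $\mu(G,\omega)=\min\{\omega(e):e\in E(G)\}$. An incentive assignment is $\mathbf{p}:V\to[0,\infty)$. The activation process for $(G,\omega,\tau,\mathbf{p})$: initially $A_0=\{v:p(v)\ge\tau(v)\}$; given the active set $A_t$, a vertex $x\notin A_t$ becomes active in round $t+1$ iff $\sum_{e\in E_t(x)}\omega(e)+p(x)\ge\tau(x)$, where $E_t(x)$ is the set of edges $xy$ with $y\in A_t$; active vertices remain active. $\mathbf{p}$ is a target vector if the process eventually activates all of $V$. OTVW asks for a target vector minimizing $\sum_{v\in V}p(v)$. *)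

(* Defs.v *)
From HB Require Import structures.
From mathcomp Require Import all_boot all_order all_algebra.
From mathcomp Require Import reals.

Set Implicit Arguments.
Unset Strict Implicit.
Unset Printing Implicit Defensive.

Import Order.TTheory GRing.Theory Num.Theory.

(** Polynomial time is that of the random access machine of Cook and Reckhow,
    with multiplication as in Aho, Hopcroft and Ullman, under the logarithmic
    cost criterion: registers [X_0, X_1, ...] hold natural numbers of unbounded
    size, and every instruction is charged the bit lengths of the numbers and of
    the indirect addresses it handles.  This machine and the multitape Turing
    machine simulate each other with polynomial overhead. *)

Inductive instr : Type :=
  | Const (i c : nat)    (* X_i := c *)
  | Add (i j k : nat)    (* X_i := X_j + X_k *)
  | Sub (i j k : nat)    (* X_i := X_j - X_k, truncated at 0 *)
  | Mul (i j k : nat)    (* X_i := X_j * X_k *)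
  | Fetch (i j : nat)     (* X_i := X_(X_j) *)
  | Store (i j : nat)    (* X_(X_i) := X_j *)
  | JumpPos (j l : nat)  (* go to instruction l if X_j > 0 *)
  | Read (i : nat)       (* X_i := next input number, 0 if none is left *)
  | Write (i : nat).     (* append X_i to the output *)

Record config : Type := Config {
  pc : nat;
  reg : nat -> nat;
  inp : seq nat;
  out : seq nat
}.

Definition exec (I : instr) (s : config) : config :=
  let: Config n X u v := s in
  match I with
  | Const i c => Config n.+1 [eta X with i |-> c] u v
  | Add i j k => Config n.+1 [eta X with i |-> X j + X k] u v
  | Sub i j k => Config n.+1 [eta X with i |-> X j - X k] u v
  | Mul i j k => Config n.+1 [eta X with i |-> X j * X k] u v
  | Fetch i j => Config n.+1 [eta X with i |-> X (X j)] u v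
  | Store i j => Config n.+1 [eta X with X i |-> X j] u v
  | JumpPos j l => Config (if 0 < X j then l else n.+1) X u v
  | Read i => Config n.+1 [eta X with i |-> head 0 u] (behead u) v
  | Write i => Config n.+1 X u (rcons v (X i))
  end.

Definition bitlen (n : nat) : nat := (trunc_log 2 n).+1.

Definition cost (I : instr) (s : config) : nat :=
  let X := reg s in
  match I with
  | Const _ c => bitlen c
  | Add _ j k | Sub _ j k | Mul _ j k => bitlen (X j) + bitlen (X k)
  | Fetch _ j => bitlen (X j) + bitlen (X (X j))
  | Store i j => bitlen (X i) + bitlen (X j)
  | JumpPos j _ => bitlen (X j)
  | Read _ => bitlen (head 0 (inp s))
  | Write i => bitlen (X i)
  end.

(** The machine halts when the program counter leaves the program. *)
Inductive run (P : seq instr) : config -> nat -> config -> Prop :=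
  | run_halt s : size P <= pc s -> run P s 0 s
  | run_step s I t s' :
      onth P (pc s) = Some I -> run P (exec I s) t s' ->
      run P s (cost I s + t) s'.

Definition computes_in (P : seq instr) (u v : seq nat) (t : nat) : Prop :=
  exists2 s, run P (Config 0 (fun=> 0) u [::]) t s & out s = v.

Definition input_size (u : seq nat) : nat := \sum_(x <- u) bitlen x.

(** [encodes x u]: the word [u] is an encoding of the instance [x];
    [answers x v]: the word [v] encodes a correct output for [x]. *)
Record problem : Type := Problem {
  instance : Type;
  encodes : instance -> seq nat -> Prop;
  answers : instance -> seq nat -> Prop
}.

Definition restrict (Q : problem) (D : instance Q -> Prop) : problem :=
  {| instance := {x : instance Q | D x};
     encodes := fun x => encodes (sval x);
     answers := fun x => answers (sval x) |}.

Definition polytime_solvable (Q : problem) : Prop :=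
  exists (P : seq instr) (c k : nat),
    forall (x : instance Q) (u : seq nat), encodes x u ->
    exists (v : seq nat) (t : nat),
      [/\ computes_in P u v t, t <= c * (input_size u).+1 ^ k & answers x v].

Local Open Scope ring_scope.

Record sgraph (V : finType) : Type := SGraph {
  edges : {set {set V}};
  card_edge : forall e, e \in edges -> #|e| = 2
}.

(** Only the values of [omega] on the edges matter. *)
Record ewgraph (R : realType) (V : finType) : Type := EWGraph {
  graph : sgraph V;
  omega : {set V} -> R;
  tau : V -> R;
  omega_ge0 : forall e, e \in edges graph -> 0 <= omega e;
  tau_ge0 : forall v, 0 <= tau v
}.

Section OTVW.
Variables (R : realType) (V : finType) (g : ewgraph R V).
Local Notation E := (edges (graph g)).

Definition incident (u : V) : {set {set V}} := [set e in E | u \in e].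

(** By convention [0] if there is no edge; the degree sums are then [0] too. *)
Definition mu : R :=
  if [pick e in E] is Some e0 then omega g [arg min_(e < e0 in E) omega g e]%O
  else 0.

Definition edges_to (x : V) (A : {set V}) : {set {set V}} :=
  [set e in E | [exists y in A, e == [set x; y]]].

Definition activate (p : V -> R) (A : {set V}) : {set V} :=
  A :|: [set x | (x \notin A) &&
                 (tau g x <= \sum_(e in edges_to x A) omega g e + p x)].

Definition active (p : V -> R) (t : nat) : {set V} :=
  iter t (activate p) [set v | tau g v <= p v].

Definition target_vector (p : V -> R) : Prop :=
  (forall v, 0 <= p v) /\ exists t, active p t = [set: V].

Definition optimal_target_vector (p : V -> R) : Prop :=
  target_vector p /\
  forall q, target_vector q -> \sum_(v : V) p v <= \sum_(v : V) q v.

End OTVW.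

(** Numbers are written as fractions of natural numbers, not necessarily in
    lowest terms. *)
Definition is_fraction (R : realType) (x : R) (a b : nat) : Prop :=
  (0 < b)%N /\ x = a%:R / b%:R.

(** A graph on ['I_n] is written as [n], its weighted adjacency matrix row by
    row, and its thresholds. *)
Definition encodes_ewgraph (R : realType) (n : nat) (g : ewgraph R 'I_n)
    (u : seq nat) : Prop :=
  exists (wa wb : {set 'I_n} -> nat) (ta tb : 'I_n -> nat),
    [/\ forall e, e \in edges (graph g) ->
          is_fraction (omega g e) (wa e) (wb e),
        forall i, is_fraction (tau g i) (ta i) (tb i)
      & u = n ::
          flatten [seq (let e := [set i; j] in
                        if e \in edges (graph g) then [:: 1%N; wa e; wb e]
                        else [:: 0%N; 0%N; 0%N])
                  | i <- enum 'I_n, j <- enum 'I_n]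
          ++ flatten [seq [:: ta i; tb i] | i <- enum 'I_n]].

Definition encodes_vector (R : realType) (n : nat) (p : 'I_n -> R)
    (v : seq nat) : Prop :=
  exists a b : 'I_n -> nat,
    (forall i, is_fraction (p i) (a i) (b i)) /\
    v = flatten [seq [:: a i; b i] | i <- enum 'I_n].

Definition OTVW (R : realType) : problem :=
  {| instance := {n : nat & ewgraph R 'I_n};
     encodes := fun x => encodes_ewgraph (projT2 x);
     answers := fun x v =>
       exists2 p, optimal_target_vector (projT2 x) p & encodes_vector p v |}.

(* Main.v *)
(** Let [T] be the set of vertices whose threshold is [mu]; the other thresholds
    are weighted degrees. Paying [mu] to one vertex in each component of the
    subgraph induced by [T] activates all of [T], as every edge weighs at least
    [mu]. Outside [T], pay each vertex [v] the weight of its edges to later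
    vertices [w > v] outside [T]; these vertices are then activated in increasing
    order. The total is [mu] times the number of components plus the weight of
    all edges with both ends outside [T].

    This is optimal. In any activation a vertex [v] outside [T] is paid at least
    the weight of its edges to vertices that are not activated before it. So
    each of those edges is paid for at one of its ends, and an edge to [T] is
    paid for if its end in [T] is not activated earlier. The first vertex of a
    component to be activated is either paid [mu] or has a neighbour outside [T]
    activated earlier, which was paid at least [mu] for the edge between them.

    The components are found by merging labels along the edges. The fractions
    are never reduced, but a sum of at most [n] of them still has polynomially
    many bits. *)

Require Import Defs.
From mathcomp Require Import all_boot all_order all_algebra.
From mathcomp Require Import reals.
Import Order.TTheory GRing.Theory Num.Theory.
From mathcomp Require Import zify.
Set Implicit Arguments.
Unset Strict Implicit.
Unset Printing Implicit Defensive.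
Local Open Scope nat_scope.

(** * Structured programs and their compilation *)

Inductive binop := Plus | Minus | Times.

Inductive expr :=
  | Var (i : nat)
  | Cst (c : nat)
  | Bin (f : binop) (a b : expr)
  | Ref (a : expr).

(** The only loop runs a number of times fixed on entry, so every program terminates and its time is
    controlled by bounding these numbers. *)
Inductive cmd :=
  | Assign (i : nat) (e : expr)
  | Update (a e : expr)
  | Input (i : nat)
  | Output (e : expr)
  | Seq (c1 c2 : cmd)
  | When (e : expr) (c : cmd)
  | For (i : nat) (e : expr) (c : cmd).

Record state := State {
  var : nat -> nat;
  heap : nat -> nat;
  rest : seq nat;
  written : seq nat
}.

Definition op (f : binop) : nat -> nat -> nat :=
  match f with Plus => addn | Minus => subn | Times => muln end.

Fixpoint eval (s : state) (e : expr) : nat :=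
  match e with
  | Var i => var s i
  | Cst c => c
  | Bin f a b => op f (eval s a) (eval s b)
  | Ref a => heap s (eval s a)
  end.

Definition set_var (s : state) (i x : nat) : state :=
  State [eta var s with i |-> x] (heap s) (rest s) (written s).

Definition set_mem (s : state) (a x : nat) : state :=
  State (var s) [eta heap s with a |-> x] (rest s) (written s).

(** Weakest preconditions for total correctness, which also demand that stored
    values are at most [M] and that loops run at most [m] times. *)
Fixpoint wp (M m : nat) (c : cmd) (Q : state -> Prop) (s : state) : Prop :=
  match c with
  | Assign i e => eval s e <= M /\ Q (set_var s i (eval s e))
  | Update a e => eval s e <= M /\ Q (set_mem s (eval s a) (eval s e))
  | Input i => Q (State [eta var s with i |-> head 0 (rest s)] (heap s)
                        (behead (rest s)) (written s))
  | Output e => Q (State (var s) (heap s) (rest s) (rcons (written s) (eval s e)))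
  | Seq c1 c2 => wp M m c1 (wp M m c2 Q) s
  | When e c => if 0 < eval s e then wp M m c Q s else Q s
  | For i e c => eval s e <= m /\
      exists I : nat -> state -> Prop,
        [/\ I 0 s,
            forall k s', k < eval s e -> I k s' -> wp M m c (I k.+1) (set_var s' i k)
          & forall s', I (eval s e) s' -> Q s']
  end.

Section Compiler.

(** Registers below [V] hold the variables, registers from [H] on hold the
    memory, and those in between are a stack of temporaries with top [d]. *)
Variables V H : nat.

Definition op_instr (f : binop) : nat -> nat -> nat -> instr :=
  match f with Plus => Add | Minus => Defs.Sub | Times => Mul end.

(** The value ends up in register [d]. A register is copied by adding it to zero. *)
Fixpoint compile_expr (d : nat) (e : expr) : seq instr :=
  match e with
  | Var i => [:: Const d 0; Add d d i]
  | Cst c => [:: Const d c]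
  | Bin f a b => compile_expr d a ++ compile_expr d.+1 b ++ [:: op_instr f d d d.+1]
  | Ref a => compile_expr d a ++ [:: Const d.+1 H; Add d d d.+1; Fetch d d]
  end.

Fixpoint code_size (c : cmd) : nat :=
  match c with
  | Assign _ e => size (compile_expr 0 e) + 2
  | Update a e => size (compile_expr 0 a) + (size (compile_expr 0 e) + 3)
  | Input _ => 1
  | Output e => size (compile_expr 0 e) + 1
  | Seq c1 c2 => code_size c1 + code_size c2
  | When e c => size (compile_expr 0 e) + (3 + code_size c)
  | For i e c => size (compile_expr 0 e) + (5 + (code_size c + 4))
  end.

(** Jumps are absolute: [o] is the address at which the code is placed. *)
Fixpoint compile (d o : nat) (c : cmd) : seq instr :=
  match c with
  | Assign i e => compile_expr d e ++ [:: Const d.+1 0; Add i d d.+1]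
  | Update a e => compile_expr d a ++ compile_expr d.+1 e ++
      [:: Const d.+2 H; Add d d d.+2; Store d d.+1]
  | Input i => [:: Read i]
  | Output e => compile_expr d e ++ [:: Write d]
  | Seq c1 c2 => compile d o c1 ++ compile d (o + code_size c1) c2
  | When e c =>
      let l := o + size (compile_expr 0 e) in
      compile_expr d e ++
      [:: JumpPos d (l + 3); Const d 1; JumpPos d (l + 3 + code_size c)] ++
      compile d (l + 3) c
  | For i e c =>
      let l := o + size (compile_expr 0 e) in
      compile_expr d e ++
      [:: Const d.+1 0; Const d.+2 1; JumpPos d.+2 (l + 5 + code_size c + 2);
          Const d.+2 0; Add i d.+1 d.+2] ++
      compile d.+2 (l + 5) c ++
      [:: Const d.+2 1; Add d.+1 d.+1 d.+2;
          Defs.Sub d.+2 d d.+1; JumpPos d.+2 (l + 3)]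
  end.

Lemma size_compile_expr d e : size (compile_expr d e) = size (compile_expr 0 e).
Proof.
elim: e d => [i|c|f a IHa b IHb|a IHa] d //=.
  by rewrite !size_cat IHa (IHb d.+1) (IHb 1).
by rewrite !size_cat IHa.
Qed.

Lemma size_compile d o c : size (compile d o c) = code_size c.
Proof.
elim: c d o => [i e|a e|i|e|c1 IH1 c2 IH2|e c IH|i e c IH] d o //=;
  rewrite !size_cat ?(size_compile_expr d) ?(size_compile_expr d.+1) //=.
- by rewrite IH1 IH2.
- by rewrite IH.
- by rewrite size_cat IH.
Qed.

Fixpoint wf_expr (d : nat) (e : expr) : bool :=
  match e with
  | Var i => (i < V) && (d < H)
  | Cst c => d < H
  | Bin _ a b => [&& wf_expr d a, wf_expr d.+1 b & d.+1 < H]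
  | Ref a => wf_expr d a && (d.+1 < H)
  end.

Fixpoint wf (d : nat) (c : cmd) : bool :=
  match c with
  | Assign i e => [&& i < V, wf_expr d e & d.+1 < H]
  | Update a e => [&& wf_expr d a, wf_expr d.+1 e & d.+2 < H]
  | Input i => (i < V) && (d < H)
  | Output e => wf_expr d e && (d < H)
  | Seq c1 c2 => wf d c1 && wf d c2
  | When e c => [&& wf_expr d e, d < H & wf d c]
  | For i e c => [&& i < V, wf_expr d e, wf d.+2 c & d.+2 < H]
  end.

(** These bound all intermediate results too, which is why a difference counts
    like a sum. *)
Fixpoint expr_bound (M : nat) (e : expr) : nat :=
  match e with
  | Var _ => M
  | Cst c => c
  | Bin _ a b => let x := expr_bound M a in let y := expr_bound M b in
      x + y + x * y
  | Ref a => expr_bound M a + H + M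
  end.

Fixpoint cmd_bound (M : nat) (c : cmd) : nat :=
  match c with
  | Assign _ e | Output e => expr_bound M e
  | Update a e => expr_bound M a + H + expr_bound M e
  | Input _ => 0
  | Seq c1 c2 => cmd_bound M c1 + cmd_bound M c2
  | When e c => expr_bound M e + cmd_bound M c + 1
  | For _ e c => expr_bound M e + cmd_bound M c + 1
  end.

(** For a loop, 5 counts three instructions of set-up and the two of the final test; 6 counts test,
    assignment of the loop variable and increment, two each per round. *)
Fixpoint step_bound (m : nat) (c : cmd) : nat :=
  match c with
  | Assign _ e => size (compile_expr 0 e) + 2
  | Update a e => size (compile_expr 0 a) + (size (compile_expr 0 e) + 3)
  | Input _ => 1
  | Output e => size (compile_expr 0 e) + 1
  | Seq c1 c2 => step_bound m c1 + step_bound m c2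
  | When e c => size (compile_expr 0 e) + (3 + step_bound m c)
  | For _ e c => size (compile_expr 0 e) + 5 + m * (step_bound m c + 6)
  end.

(** * Code placement and execution with bounded cost *)

Definition code_at (P : seq instr) (o : nat) (cs : seq instr) : Prop :=
  forall i, i < size cs -> onth P (o + i) = onth cs i.

Lemma code_at_cat P o c1 c2 :
  code_at P o (c1 ++ c2) -> code_at P o c1 /\ code_at P (o + size c1) c2.
Proof.
move=> hP; split=> i hi.
  by rewrite hP ?onth_cat ?hi // size_cat ltn_addr.
by rewrite -addnA hP ?onth_cat ?size_cat ?ltn_add2l // ltnNge leq_addr /= addKn.
Qed.

Lemma code_at_cons P o I cs :
  code_at P o (I :: cs) -> onth P o = Some I /\ code_at P o.+1 cs.
Proof.
move=> hP; split; first by rewrite -[o]addn0 hP.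
by move=> i hi; rewrite addSnnS hP.
Qed.

(** Since [run] describes only halting runs, a partial execution is what can be put in front of any
    of them. The inequality saves tracking exact costs. *)
Definition reach (P : seq instr) (s : config) (T : nat) (s' : config) : Prop :=
  forall t f, run P s' t f -> exists2 t', t' <= T + t & run P s t' f.

Lemma reach_refl P s : reach P s 0 s.
Proof. by move=> t f r; exists t. Qed.

Lemma reach_trans P s1 s2 s3 T1 T2 :
  reach P s1 T1 s2 -> reach P s2 T2 s3 -> reach P s1 (T1 + T2) s3.
Proof.
move=> r1 r2 t f /r2[t2 le2 /r1[t1 le1 run1]]; exists t1 => //.
by rewrite -addnA (leq_trans le1) // leq_add2l.
Qed.

Lemma reach_le P s s' T T' : T <= T' -> reach P s T s' -> reach P s T' s'.
Proof.
move=> le r t f /r[t' le' run']; exists t' => //.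
by rewrite (leq_trans le') // leq_add2r.
Qed.

Lemma leq_bitlen a b : a <= b -> bitlen a <= bitlen b.
Proof. by move=> le; rewrite ltnS leq_trunc_log. Qed.

(** * Correctness and cost of compiled code *)

Section Soundness.

Variables M m B : nat.
Hypothesis leMB : M <= B.
Hypothesis lemM : m <= M.
(** An instruction is charged for at most two numbers, so this bounds its cost while all numbers are
    at most [B]. *)
Let L := 2 * bitlen B.

Lemma reach_cons P I cs p X u v T s :
  code_at P p (I :: cs) -> cost I (Config p X u v) <= L ->
  (code_at P p.+1 cs -> reach P (exec I (Config p X u v)) T s) ->
  reach P (Config p X u v) (L + T) s.
Proof.
case/code_at_cons=> hI hcs le /(_ hcs) r t f /r[t' le' run'].
exists (cost I (Config p X u v) + t'); last first.
  exact: (@run_step _ (Config p X u v)) hI run'.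
by rewrite -addnA leq_add.
Qed.

Definition bounded (X : nat -> nat) := forall r, X r <= B.

Lemma leq_cost1 a : a <= B -> bitlen a <= L.
Proof. by move/leq_bitlen => le; rewrite (leq_trans le) // leq_pmull. Qed.

Lemma leq_cost2 a b : a <= B -> b <= B -> bitlen a + bitlen b <= L.
Proof. by move=> /leq_bitlen la /leq_bitlen lb; rewrite /L mul2n -addnn leq_add. Qed.

Definition represents (X : nat -> nat) (s : state) : Prop :=
  (forall i, i < V -> X i = var s i) /\ (forall a, X (H + a) = heap s a).

Definition small (s : state) : Prop :=
  [/\ forall i, i < V -> var s i <= M, forall a, heap s a <= M
    & forall x, x \in rest s -> x <= M].

Lemma op_bound f a b x y : a <= x -> b <= y -> op f a b <= x + y + x * y.
Proof. by case: f => /=; nia. Qed.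

Lemma eval_bound s d e : wf_expr d e -> small s -> eval s e <= expr_bound M e.
Proof.
move=> + [hv hm _]; elim: e d => [i|c|f a IHa b IHb|a IHa] d //=.
- by case/andP=> /hv.
- by case/and3P=> /IHa ? /IHb ? _; apply: op_bound.
- by move=> _; rewrite (leq_trans (hm _)) // leq_addl.
Qed.

Lemma represents_eq X X' s d :
  V <= d -> (forall r, (r < d) || (H <= r) -> X' r = X r) ->
  represents X s -> represents X' s.
Proof.
move=> Vd eqX [hv hm]; split=> [i iV|a].
  by rewrite eqX ?hv // (leq_trans iV Vd).
by rewrite eqX ?hm // leq_addr orbT.
Qed.

Lemma bounded_set X i x : x <= B -> bounded X -> bounded [eta X with i |-> x].
Proof. by move=> le bX r /=; case: eqP. Qed.

(** Only registers from [d] on and below [H] change, so variables, memory and pending operands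
    survive; a binary operation relies on this for its left operand. *)
Lemma compile_exprP e d o P X u v s :
  code_at P o (compile_expr d e) -> V <= d -> wf_expr d e -> represents X s ->
  small s -> expr_bound M e <= B -> H <= B -> bounded X ->
  exists X', [/\ X' d = eval s e,
    forall r, (r < d) || (H <= r) -> X' r = X r,
    bounded X' &
    reach P (Config o X u v) (size (compile_expr 0 e) * L)
      (Config (o + size (compile_expr 0 e)) X' u v)].
Proof.
elim: e d o X => [i|c|f a IHa b IHb|a IHa] d o X /=.
- move=> hP Vd /andP[iV dH] rX [hv hm _] _ _ bX.
  have bI : var s i <= B by rewrite (leq_trans (hv _ iV)).
  have di : (i == d) = false by apply/eqP; lia.
  rewrite addn2 mulSn mul1n; eexists; split; last first.
  + apply: (reach_cons hP) => [|hP1]; first exact: leq_cost1.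
    rewrite -[X in reach _ _ X _]addn0.
    apply: (reach_cons hP1) => [|_]; last exact: reach_refl.
    by rewrite /= eqxx di; apply: leq_cost2.
  + apply: bounded_set; last exact: bounded_set.
    by rewrite /= eqxx di; apply: bX.
  + by move=> r hr /=; case: eqP => //; lia.
  + by rewrite /= !eqxx di rX.1.
- move=> hP Vd dH rX sm cB _ bX.
  rewrite addn1 mul1n; eexists; split; last first.
  + rewrite -[X in reach _ _ X _]addn0.
    apply: (reach_cons hP) => [|_]; last exact: reach_refl.
    exact: leq_cost1.
  + exact: bounded_set.
  + by move=> r hr /=; case: eqP => //; lia.
  + by rewrite /= !eqxx.
- case/code_at_cat=> hPa /code_at_cat[hPb hPf] Vd /and3P[wa wb dH] rX sm.
  move=> bab HB bX.
  have [Xa [ea fa bXa ra]] := IHa _ _ _ hPa Vd wa rX sm ltac:(lia) HB bX.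
  have rXa := represents_eq Vd fa rX.
  have [Xb [eb fb bXb rb]] :=
    IHb _ _ _ hPb (leqW Vd) wb rXa sm ltac:(lia) HB bXa.
  move: hPf ra rb; rewrite !(size_compile_expr d) !(size_compile_expr d.+1).
  move=> hPf ra rb.
  have opB : op f (Xb d) (Xb d.+1) <= B.
    rewrite eb fb ?ltnSn // ea (leq_trans _ bab) //.
    by apply: op_bound; apply: eval_bound sm; eassumption.
  rewrite !size_cat /= (size_compile_expr 1) !mulnDl !addnA addn1 mul1n -addnA.
  eexists; split; last first.
  + apply: (reach_trans ra); apply: (reach_trans rb).
    rewrite -[X in reach _ _ X _]addn0.
    apply: (reach_cons hPf) => [|_].
      by case: (f); apply: leq_cost2.
    have -> : exec (op_instr f d d d.+1) (Config
        (o + size (compile_expr 0 a) + size (compile_expr 0 b)) Xb u v) =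
      Config (o + size (compile_expr 0 a) + size (compile_expr 0 b)).+1
        [eta Xb with d |-> op f (Xb d) (Xb d.+1)] u v by case: (f).
    exact: reach_refl.
  + exact: bounded_set.
  + move=> r hr /=; case: eqP => [|_]; first lia.
    by rewrite fb ?fa //; lia.
  + by rewrite /= eqxx eb fb ?ltnSn // ea.
- case/code_at_cat=> hPa hP Vd /andP[wa dH] rX sm bab HB bX.
  have [Xa [ea fa bXa ra]] := IHa _ _ _ hPa Vd wa rX sm ltac:(lia) HB bX.
  have rXa := represents_eq Vd fa rX.
  move: hP ra; rewrite !(size_compile_expr d) => hP ra.
  have aB := eval_bound wa sm.
  have mB : heap s (eval s a) <= B by case: sm => _ /(_ (eval s a)); lia.
  have Xd : Xa (eval s a + H) = heap s (eval s a) by rewrite addnC rXa.2.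
  have nd : (d == d.+1) = false by apply/eqP; lia.
  have ne1 : (eval s a + H == d) = false by apply/eqP; lia.
  have ne2 : (eval s a + H == d.+1) = false by apply/eqP; lia.
  rewrite size_cat mulnDl /= addnA addn3; eexists; split; last first.
  + apply: (reach_trans ra); rewrite !mulSn mul0n.
    apply: (reach_cons hP) => [|hP1]; first exact: leq_cost1.
    apply: (reach_cons hP1) => [|hP2].
      by rewrite /= eqxx nd; apply: leq_cost2.
    apply: (reach_cons hP2) => [|_]; last exact: reach_refl.
    rewrite /= !eqxx nd ea ne1 ne2 Xd.
    by apply: leq_cost2 => //; lia.
  + do !apply: bounded_set => //; rewrite /= ?eqxx ?nd ?ea ?ne1 ?ne2 ?Xd //; lia.
  + by move=> r hr /=; do 3?[case: eqP => [|_]; first lia]; rewrite fa.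
  + by rewrite /= !eqxx nd ea ne1 ne2 Xd.
Qed.

Lemma represents_set_var X s i x :
  V <= H -> i < V -> represents X s ->
  represents [eta X with i |-> x] (set_var s i x).
Proof.
move=> VH iV [hv hm]; split=> [j jV|a] /=; first by rewrite hv.
by case: eqP => [|_]; [lia | apply: hm].
Qed.

Lemma represents_set_mem X s a x :
  V <= H -> represents X s -> represents [eta X with H + a |-> x] (set_mem s a x).
Proof.
move=> VH [hv hm]; split=> [j jV|b] /=; last by rewrite eqn_add2l hm.
by case: eqP => [|_]; [lia | apply: hv].
Qed.

Lemma small_set_var s i x : x <= M -> small s -> small (set_var s i x).
Proof. by move=> xM [hv hm hr]; split=> //= j jV; case: eqP => // _; apply: hv. Qed.

Lemma small_set_mem s a x : x <= M -> small s -> small (set_mem s a x).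
Proof. by move=> xM [hv hm hr]; split=> //= j; case: eqP. Qed.

Lemma reach_eq P s1 s2 s3 T : s2 = s3 -> reach P s1 T s2 -> reach P s1 T s3.
Proof. by move=> ->. Qed.

(** Induction on the command. The stack below [d] is preserved, which lets a loop keep its bound and
    counter there while its body runs two places higher. *)
Lemma compileP c d o P X s (Q : state -> Prop) :
  code_at P o (compile d o c) -> V <= d -> wf d c -> represents X s -> small s ->
  cmd_bound M c <= B -> H <= B -> 0 < B -> bounded X -> wp M m c Q s ->
  exists X' s', [/\ Q s', represents X' s', small s', bounded X' &
    (forall r, V <= r < d -> X' r = X r) /\
    reach P (Config o X (rest s) (written s)) (step_bound m c * L)
      (Config (o + code_size c) X' (rest s') (written s'))].
Proof.
elim: c d o X s Q => [i e|a e|i|e|c1 IH1 c2 IH2|e c IH|i e c IH] d o X s Q /=.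
- case/code_at_cat=> hPe hP Vd /and3P[iV we dH] rX sm cB HB B0 bX [eM hQ].
  have [Xe [ee fe bXe re]] :=
    compile_exprP (rest s) (written s) hPe Vd we rX sm cB HB bX.
  move: hP; rewrite size_compile_expr => hP.
  have rXe := represents_eq Vd fe rX.
  have nd : (d == d.+1) = false by apply/eqP; lia.
  exists [eta [eta Xe with d.+1 |-> 0] with i |-> eval s e].
  exists (set_var s i (eval s e)); split=> //.
  + apply: represents_set_var => //; first lia.
    apply: (@represents_eq Xe _ _ d.+1) => //; first exact: leqW.
    by move=> r hr /=; case: eqP => //; lia.
  + exact: small_set_var.
  + by do 2?apply: bounded_set => //; rewrite (leq_trans eM).
  + split=> [r hr|] /=.
      by do 2?[case: eqP => [|_]; first lia]; rewrite fe //; lia.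
    rewrite mulnDl addnA addn2; apply: (reach_trans re).
    rewrite mulSn; apply: (reach_cons hP) => [|hP1]; first exact: leq_cost1.
    rewrite mul1n -[X in reach _ _ X _]addn0.
    apply: (reach_cons hP1) => [|_].
      by rewrite /= eqxx nd; apply: leq_cost2.
    by rewrite /= !eqxx nd ee addn0; apply: reach_refl.
- case/code_at_cat=> hPa /code_at_cat[hPe hP] Vd /and3P[wa we dH] rX sm.
  move=> cB HB B0 bX [eM hQ].
  have [Xa [ea fa bXa ra]] :=
    compile_exprP (rest s) (written s) hPa Vd wa rX sm ltac:(lia) HB bX.
  have rXa := represents_eq Vd fa rX.
  have [Xe [ee fe bXe re]] :=
    compile_exprP (rest s) (written s) hPe (leqW Vd) we rXa sm ltac:(lia) HB bXa.
  have rXe := represents_eq (leqW Vd) fe rXa.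
  move: hP re; rewrite !size_compile_expr => hP re.
  have aB := eval_bound wa sm.
  have eB : eval s e <= B by rewrite (leq_trans eM).
  have nd : (d == d.+2) = false by apply/eqP; lia.
  have nd1 : (d.+1 == d.+2) = false by apply/eqP; lia.
  have nd2 : (d.+1 == d) = false by apply/eqP; lia.
  have Xd : Xe d = eval s a by rewrite fe ?ltnSn.
  exists [eta [eta [eta Xe with d.+2 |-> H] with d |-> H + eval s a]
    with H + eval s a |-> eval s e].
  exists (set_mem s (eval s a) (eval s e)); split=> //; last first.
  + split; last first.
      rewrite !mulnDl !addnA addn3 -[X in reach _ _ X _]addnA.
      apply: (reach_trans ra); apply: (reach_trans re); rewrite !mulSn mul0n.
      apply: (reach_cons hP) => [|hP1]; first exact: leq_cost1.
      apply: (reach_cons hP1) => [|hP2].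
        by rewrite /= eqxx nd; apply: leq_cost2.
      apply: (reach_cons hP2) => [|_].
        rewrite /= !eqxx nd nd1 nd2 Xd.
        by apply: leq_cost2; rewrite ?ee //; lia.
      by rewrite /= !eqxx nd nd1 nd2 Xd ee [eval s a + H]addnC; apply: reach_refl.
    move=> r hr /=; do 3?[case: eqP => [|_]; first lia].
    by rewrite fe ?fa //; lia.
  + apply: bounded_set => //; apply: bounded_set; last exact: bounded_set.
    by lia.
  + exact: small_set_mem.
  + apply: represents_set_mem; first lia.
    apply: (@represents_eq Xe _ _ d) => // r hr /=.
    by do 2?[case: eqP => [|_]; first lia].
- move=> hP Vd /andP[iV dH] rX sm _ _ _ bX hQ; have [hv hm hr] := sm.
  have hh : head 0 (rest s) <= M.
    by case: (rest s) hr => //= x ? /(_ x); apply; rewrite mem_head.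
  exists [eta X with i |-> head 0 (rest s)]; eexists; split; first exact: hQ.
  + split=> [j jV|a] /=; first by rewrite rX.1.
    by case: eqP => [|_]; [lia | apply: rX.2].
  + split=> //= [j jV|x xr]; first by case: eqP => // _; apply: hv.
    by apply: hr; apply: mem_behead.
  + by apply: bounded_set => //; rewrite (leq_trans hh).
  + split=> [r hr'|] /=; first by case: eqP => //; lia.
    rewrite mul1n addn1 -[X in reach _ _ X _]addn0.
    apply: (reach_cons hP) => [|_]; last exact: reach_refl.
    by apply: leq_cost1; rewrite (leq_trans hh).
- case/code_at_cat=> hPe hP Vd /andP[we dH] rX sm cB HB B0 bX hQ.
  have [Xe [ee fe bXe re]] :=
    compile_exprP (rest s) (written s) hPe Vd we rX sm cB HB bX.
  move: hP; rewrite size_compile_expr => hP.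
  have rXe := represents_eq Vd fe rX.
  exists Xe; eexists; split; first exact: hQ; [by [] | by [] | by [] |].
  split=> [r hr|] /=; first by rewrite fe //; lia.
  rewrite mulnDl addnA addn1 mul1n; apply: (reach_trans re).
  rewrite -[X in reach _ _ X _]addn0.
  apply: (reach_cons hP) => [|_]; first exact: leq_cost1.
  by rewrite /= ee; apply: reach_refl.
- case/code_at_cat=> hP1 hP2 Vd /andP[w1 w2] rX sm cB HB B0 bX hwp.
  have [X1 [s1 [hwp1 rX1 sm1 bX1 [f1 r1]]]] :=
    IH1 _ _ _ _ _ hP1 Vd w1 rX sm ltac:(lia) HB B0 bX hwp.
  move: hP2; rewrite size_compile => hP2.
  have [X2 [s2 [hQ rX2 sm2 bX2 [f2 r2]]]] :=
    IH2 _ _ _ _ _ hP2 Vd w2 rX1 sm1 ltac:(lia) HB B0 bX1 hwp1.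
  exists X2, s2; split=> //; split=> [r hr|]; first by rewrite f2 ?f1.
  by rewrite mulnDl addnA; apply: reach_trans r1 r2.
- case/code_at_cat=> hPe; rewrite size_compile_expr; set l := o + _.
  case/(@code_at_cat _ _ [:: _; _; _]) => hJ hPc Vd /and3P[we dH wc] rX sm.
  move=> cB HB B0 bX hwp.
  have [Xe [ee fe bXe re]] :=
    compile_exprP (rest s) (written s) hPe Vd we rX sm ltac:(lia) HB bX.
  have rXe := represents_eq Vd fe rX.
  have Vr r : V <= r < d -> Xe r = X r by move=> hr; rewrite fe //; lia.
  rewrite !mulnDl !addnA -/l in re *; case: ifP hwp => he hwp.
    have [X1 [s1 [hQ rX1 sm1 bX1 [f1 r1]]]] :=
      IH _ _ _ _ _ hPc Vd wc rXe sm ltac:(lia) HB B0 bXe hwp.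
    exists X1, s1; split=> //; split=> [r hr|]; first by rewrite f1 ?Vr.
    apply: (reach_le _ (reach_trans re _)); last first.
      apply: (reach_cons hJ) => [|_]; first exact: leq_cost1.
      by rewrite /= ee he; apply: r1.
    lia.
  exists [eta Xe with d |-> 1], s; split=> //.
  - by apply: (@represents_eq Xe _ _ d) => // r hr /=; case: eqP => //; lia.
  - exact: bounded_set.
  - split=> [r hr|]; first by rewrite -Vr //=; case: eqP => //; lia.
    apply: (reach_le _ (reach_trans re _)); last first.
      apply: (reach_cons hJ) => [|hJ1]; first exact: leq_cost1.
      rewrite /= ee he.
      apply: (reach_cons hJ1) => [|hJ2]; first exact: leq_cost1.
      apply: (reach_cons hJ2) => [|_]; first by rewrite /= eqxx; apply: leq_cost1.
      by rewrite /= eqxx; apply: reach_refl.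
    lia.
- case/code_at_cat=> hPe; rewrite size_compile_expr; set l := o + _.
  case/(@code_at_cat _ _ [:: _; _; _; _; _]) => hI /code_at_cat[hPc].
  rewrite size_compile [size _]/= => hT Vd /and4P[iV we wc dH] rX sm.
  move=> cB HB B0 bX [em [I [I0 IS IQ]]].
  have [Xe [ee fe bXe re]] :=
    compile_exprP (rest s) (written s) hPe Vd we rX sm ltac:(lia) HB bX.
  have rXe := represents_eq Vd fe rX.
  have Vr r : V <= r < d -> Xe r = X r by move=> hr; rewrite fe //; lia.
  have [hI0 hI3] : code_at P l (take 3 [:: Const d.+1 0; Const d.+2 1;
      JumpPos d.+2 (l + 5 + code_size c + 2); Const d.+2 0; Add i d.+1 d.+2]) /\
    code_at P (l + 3) [:: Const d.+2 0; Add i d.+1 d.+2].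
    exact: (@code_at_cat _ _ [:: _; _; _]).
  have [hT0 hT2] : code_at P (l + 5 + code_size c)
      [:: Const d.+2 1; Add d.+1 d.+1 d.+2] /\
    code_at P (l + 5 + code_size c + 2)
      [:: Defs.Sub d.+2 d d.+1; JumpPos d.+2 (l + 3)].
    exact: (@code_at_cat _ _ [:: _; _]).
  set n := eval s e in em IS IQ ee *.
  have nB : n <= B by lia.
  have n1 : (d == d.+1) = false by apply/eqP; lia.
  have n2 : (d == d.+2) = false by apply/eqP; lia.
  have n3 : (d.+1 == d.+2) = false by apply/eqP; lia.
  have n4 : (d.+2 == d.+1) = false by apply/eqP; lia.
  (* Register [d] holds the number of rounds and [d.+1] the counter, so the body may overwrite the
     loop variable. The test stands behind the body and is reached first by a jump. The induction is
     on the number [j] of remaining rounds. *)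
  have loop j k X1 s1 : k + j = n -> I k s1 -> represents X1 s1 -> small s1 ->
    bounded X1 -> X1 d = n -> X1 d.+1 = k ->
    exists X' s', [/\ Q s', represents X' s', small s', bounded X' &
      (forall r, V <= r < d -> X' r = X1 r) /\
      reach P (Config (l + 5 + code_size c + 2) X1 (rest s1) (written s1))
        ((2 + j * (step_bound m c + 6)) * L)
        (Config (l + 5 + code_size c + 4) X' (rest s') (written s'))].
    elim: j k X1 s1 => [|j IHj] k X1 s1 kj Ik rX1 sm1 bX1 Xd Xd1.
      exists [eta X1 with d.+2 |-> 0], s1; split=> //.
      - by apply: IQ; rewrite -kj addn0.
      - apply: (@represents_eq X1 _ _ d) => // r hr /=.
        by case: eqP => //; lia.
      - exact: bounded_set.
      - split=> [r hr|] /=; first by case: eqP => //; lia.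
        rewrite mulSn mul1n -[X in reach _ _ (L + X) _]addn0.
        apply: (reach_cons hT2) => [|hT3]; first exact: leq_cost2.
        apply: (reach_cons hT3) => [|_].
          by rewrite /= eqxx; apply: leq_cost1; lia.
        have E : n - k = 0 by lia.
        rewrite /= eqxx Xd Xd1 E ltnn.
        by apply: (reach_eq _ (@reach_refl _ _)); congr Config; lia.
    have kn : k < n by lia.
    have kM : k <= M by lia.
    have ni : (d == i) = false by apply/eqP; lia.
    have ni1 : (d.+1 == i) = false by apply/eqP; lia.
    pose X2 := [eta [eta [eta X1 with d.+2 |-> n - k] with d.+2 |-> 0]
      with i |-> k].
    have r2 : reach P
        (Config (l + 5 + code_size c + 2) X1 (rest s1) (written s1)) (4 * L)
        (Config (l + 5) X2 (rest (set_var s1 i k)) (written (set_var s1 i k))).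
      have E : 0 < n - k by lia.
      rewrite !mulSn mul0n; apply: (reach_cons hT2) => [|hT3].
        exact: leq_cost2.
      apply: (reach_cons hT3) => [|_].
        by rewrite /= eqxx; apply: leq_cost1; lia.
      rewrite /= eqxx Xd Xd1 E.
      apply: (reach_cons hI3) => [|hI4]; first exact: leq_cost1.
      apply: (reach_cons hI4) => [|_].
        by rewrite /= eqxx n3; apply: leq_cost2; rewrite ?Xd1 //; lia.
      apply: (reach_eq _ (@reach_refl _ _)).
      by rewrite /= eqxx n3 Xd1 addn0; congr Config; lia.
    have rX2 : represents X2 (set_var s1 i k).
      apply: represents_set_var => //; first lia.
      apply: (@represents_eq X1 _ _ d) => // r hr /=.
      by do 2?[case: eqP => [|_]; first lia].
    have bX2 : bounded X2 by do 3?apply: bounded_set => //; lia.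
    have [X3 [s3 [Ik3 rX3 sm3 bX3 [f3 r3]]]] :=
      IH _ _ _ _ _ hPc (leqW (leqW Vd)) wc rX2 (small_set_var i kM sm1) ltac:(lia)
        HB B0 bX2 (IS _ _ kn Ik).
    have X3d1 : X3 d.+1 = k by rewrite f3 /= ?ni1 ?n3 ?Xd1 //; lia.
    have X3d : X3 d = n by rewrite f3 /= ?ni ?n2 ?Xd //; lia.
    pose X4 := [eta [eta X3 with d.+2 |-> 1] with d.+1 |-> k.+1].
    have r4 : reach P
        (Config (l + 5 + code_size c) X3 (rest s3) (written s3)) (2 * L)
        (Config (l + 5 + code_size c + 2) X4 (rest s3) (written s3)).
      rewrite !mulSn mul0n; apply: (reach_cons hT0) => [|hT1].
        exact: leq_cost1.
      apply: (reach_cons hT1) => [|_].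
        by rewrite /= eqxx n3; apply: leq_cost2; rewrite ?X3d1 //; lia.
      apply: (reach_eq _ (@reach_refl _ _)).
      by rewrite /= eqxx n3 X3d1 addn1; congr Config; lia.
    have rX4 : represents X4 s3.
      apply: (@represents_eq X3 _ _ d) => // r hr /=.
      by do 2?[case: eqP => [|_]; first lia].
    have bX4 : bounded X4 by do 2?apply: bounded_set => //; lia.
    have [X5 [s5 [hQ rX5 sm5 bX5 [f5 r5]]]] := IHj k.+1 X4 s3 ltac:(lia) Ik3 rX4
      sm3 bX4 ltac:(by rewrite /= n1 n2) ltac:(by rewrite /= eqxx).
    exists X5, s5; split=> //; split=> [r hr|].
      rewrite f5 //= ; do 2?[case: eqP => [|_]; first lia].
      rewrite f3 /=; last lia.
      by do 3?[case: eqP => [|_]; first lia].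
    apply: (reach_le _ (reach_trans r2 (reach_trans r3 (reach_trans r4 r5)))).
    lia.
  pose X1 := [eta [eta Xe with d.+1 |-> 0] with d.+2 |-> 1].
  have rX1 : represents X1 s.
    apply: (@represents_eq Xe _ _ d) => // r hr /=.
    by do 2?[case: eqP => [|_]; first lia].
  have bX1 : bounded X1 by do 2?apply: bounded_set.
  have [X2 [s2 [hQ rX2 sm2 bX2 [f2 r2]]]] := loop n 0 X1 s (add0n n) I0 rX1 sm
    bX1 ltac:(by rewrite /= n1 n2) ltac:(by rewrite /= n3 eqxx).
  exists X2, s2; split=> //; split=> [r hr|].
    by rewrite f2 //=; do 2?[case: eqP => [|_]; first lia]; rewrite Vr.
  have r1 : reach P (Config l Xe (rest s) (written s)) (3 * L)
      (Config (l + 5 + code_size c + 2) X1 (rest s) (written s)).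
    rewrite !mulSn mul0n; apply: (reach_cons hI0) => [|hI1].
      exact: leq_cost1.
    apply: (reach_cons hI1) => [|hI2]; first exact: leq_cost1.
    apply: (reach_cons hI2) => [|_]; last first.
      by rewrite /= eqxx; apply: reach_refl.
    by rewrite /= eqxx; apply: leq_cost1.
  rewrite !addnA -/l.
  apply: (reach_le _ (reach_trans re (reach_trans r1 r2))).
  rewrite -!mulnDl leq_mul2r; apply/orP; right.
  have := leq_mul em (leqnn (step_bound m c + 6)); lia.
Qed.

End Soundness.

Lemma compile_correct c M m u (Q : state -> Prop) :
  wf V c -> V <= H -> m <= M -> (forall x, x \in u -> x <= M) ->
  wp M m c Q (State (fun=> 0) (fun=> 0) u [::]) ->
  exists s t, [/\ computes_in (compile V 0 c) u (written s) t,
    t <= step_bound m c * (2 * bitlen (cmd_bound M c + H + M + 1)) & Q s].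
Proof.
move=> wfc VH mM uM hwp.
set B := cmd_bound M c + H + M + 1.
have hP : code_at (compile V 0 c) 0 (compile V 0 c) by move=> i _; rewrite add0n.
have rX : represents (fun=> 0) (State (fun=> 0) (fun=> 0) u [::]) by split.
have sm : small M (State (fun=> 0) (fun=> 0) u [::]) by split.
have bX : bounded B (fun=> 0) by [].
have [X' [s [hQ _ _ _ [_ r]]]] := @compileP M m B ltac:(rewrite /B; lia) mM c V 0
  _ _ _ Q hP (leqnn V) wfc rX sm ltac:(rewrite /B; lia) ltac:(rewrite /B; lia)
  ltac:(rewrite /B; lia) bX hwp.
have [|t le run] := r 0 (Config (code_size c) X' (rest s) (written s)).
  by apply: run_halt; rewrite /= size_compile.
exists s, t; split=> //; last by rewrite addn0 in le.
by exists (Config (code_size c) X' (rest s) (written s)).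
Qed.

(** * Polynomial bounds on steps and bit lengths *)

Lemma step_bound_poly c : exists a k, forall m, step_bound m c <= a * m.+1 ^ k.
Proof.
have mono m j k : j <= k -> m.+1 ^ j <= m.+1 ^ k by exact: leq_pexp2l.
elim: c => [i e|a e|i|e|c1 [a1 [k1 h1]] c2 [a2 [k2 h2]]
  |e c [a [k h]]|i e c [a [k h]]] /=.
- by exists (size (compile_expr 0 e) + 2), 0 => m; rewrite muln1.
- exists (size (compile_expr 0 a) + (size (compile_expr 0 e) + 3)), 0 => m.
  by rewrite muln1.
- by exists 1, 0.
- by exists (size (compile_expr 0 e) + 1), 0 => m; rewrite muln1.
- exists (a1 + a2), (k1 + k2) => m; rewrite mulnDl leq_add //.
    by rewrite (leq_trans (h1 m)) // leq_mul2l mono ?orbT // leq_addr.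
  by rewrite (leq_trans (h2 m)) // leq_mul2l mono ?orbT // leq_addl.
- exists (size (compile_expr 0 e) + 3 + a), k => m; rewrite addnA mulnDl leq_add //.
  by rewrite leq_pmulr // expn_gt0.
- exists (size (compile_expr 0 e) + 5 + (a + 6)), k.+1 => m.
  rewrite mulnDl leq_add //; first by rewrite leq_pmulr // expn_gt0.
  rewrite mulnC expnSr mulnA leq_mul // mulnDl leq_add //.
  by rewrite leq_pmulr // expn_gt0.
Qed.

(** For fixed code the bound is a polynomial in [M], hence below a fixed power of every [M > 1];
    constants are absorbed by [c < M ^ c]. *)
Lemma expr_bound_exp e : exists q, forall M, 1 < M -> expr_bound M e <= M ^ q.
Proof.
elim: e => [i|c|f a [p hp] b [q hq]|a [p hp]] /=.
- by exists 1 => M; rewrite expn1.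
- by exists c => M M1; apply/ltnW/ltn_expl.
- exists (p + q + 2) => M M1; have := hp M M1; have := hq M M1.
  have p0 : 0 < M ^ p by rewrite expn_gt0; lia.
  have q0 : 0 < M ^ q by rewrite expn_gt0; lia.
  rewrite !expnD => le1 le2.
  have := leq_mul le2 le1; have : 4 <= M ^ 2 by rewrite -[4]/(2 ^ 2) leq_exp2r.
  have : M ^ p <= M ^ p * M ^ q by rewrite leq_pmulr.
  have : M ^ q <= M ^ p * M ^ q by rewrite leq_pmull.
  by move: (M ^ p * M ^ q) (M ^ 2) => x y; nia.
- exists (p + H + 3) => M M1; have := hp M M1.
  have hH : H < M ^ H by apply: ltn_expl.
  have p0 : 0 < M ^ p by rewrite expn_gt0; lia.
  rewrite !expnD => le1.
  have x1 : M ^ p <= M ^ p * M ^ H by rewrite leq_pmulr //; lia.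
  have x2 : M ^ H <= M ^ p * M ^ H by rewrite leq_pmull.
  have x3 : M * 4 <= M ^ 3.
    by rewrite expnS leq_mul2l -[4]/(2 ^ 2) leq_exp2r // M1 orbT.
  by move: (M ^ p * M ^ H) (M ^ 3) x1 x2 x3 => x y; nia.
Qed.

Lemma cmd_bound_exp c : exists q, forall M, 1 < M -> cmd_bound M c <= M ^ q.
Proof.
have sum3 M p q r x y : 1 < M -> p <= M ^ q -> r <= M ^ x -> y <= M ->
  p + r + y <= M ^ (q + x + 2).
  move=> M1 hp hr hy.
  have q0 : 0 < M ^ q by rewrite expn_gt0; lia.
  have x0 : 0 < M ^ x by rewrite expn_gt0; lia.
  rewrite !expnD.
  have x1 : M ^ q <= M ^ q * M ^ x by rewrite leq_pmulr.
  have x2 : M ^ x <= M ^ q * M ^ x by rewrite leq_pmull.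
  have w : 2 + M <= M ^ 2 by rewrite expnS expn1; nia.
  have := leq_mul (leqnn (M ^ q * M ^ x)) w.
  have : M <= M ^ q * M ^ x * M by rewrite leq_pmull // muln_gt0 q0.
  by move: (M ^ q * M ^ x) x1 x2 (M ^ 2) => z; lia.
elim: c => [i e|a e|i|e|c1 [q1 h1] c2 [q2 h2]|e c [q h]|i e c [q h]] /=.
- exact: expr_bound_exp.
- have [p hp] := expr_bound_exp a; have [q hq] := expr_bound_exp e.
  exists (p + q + 2 + H + 2) => M M1; rewrite addnAC -[_ + H]addn0.
  apply: (sum3) => //; last by apply/ltnW/ltn_expl.
  by have := sum3 _ _ _ _ _ 0 M1 (hp M M1) (hq M M1) (leq0n _); rewrite addn0.
- by exists 0.
- exact: expr_bound_exp.
- exists (q1 + q2 + 2) => M M1; rewrite -[cmd_bound M c1 + _]addn0.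
  exact: sum3 _ _ _ _ _ 0 M1 (h1 M M1) (h2 M M1) (leq0n _).
- have [p hp] := expr_bound_exp e; exists (p + q + 2) => M M1.
  exact: sum3 _ _ _ _ _ 1 M1 (hp M M1) (h M M1) (ltnW M1).
- have [p hp] := expr_bound_exp e; exists (p + q + 2) => M M1.
  exact: sum3 _ _ _ _ _ 1 M1 (hp M M1) (h M M1) (ltnW M1).
Qed.

(** A fixed power of [2 ^ x] has a number of bits linear in [x]. *)
Lemma bitlen_bound c : exists q, forall x, 0 < x ->
  bitlen (cmd_bound (2 ^ x) c + H + 2 ^ x + 1) <= q * x.
Proof.
have [q hq] := cmd_bound_exp c; exists (q + H + 4) => x x0.
have M1 : 1 < 2 ^ x by rewrite -{1}(expn0 2) ltn_exp2l.
have Mq : 0 < (2 ^ x) ^ q by rewrite !expn_gt0.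
have MH : H < (2 ^ x) ^ H by apply: ltn_expl.
have : cmd_bound (2 ^ x) c + H + 2 ^ x + 1 < (2 ^ x) ^ (q + H + 3).
  have := hq _ M1; rewrite !expnD.
  have x1 : (2 ^ x) ^ q <= (2 ^ x) ^ q * (2 ^ x) ^ H by rewrite leq_pmulr //; lia.
  have x2 : (2 ^ x) ^ H <= (2 ^ x) ^ q * (2 ^ x) ^ H by rewrite leq_pmull.
  have x3 : 2 ^ x * 4 <= (2 ^ x) ^ 3.
    by rewrite expnS leq_mul2l -[4]/(2 ^ 2) leq_exp2r // M1 orbT.
  move: ((2 ^ x) ^ q * (2 ^ x) ^ H) ((2 ^ x) ^ 3) x1 x2 x3 => y z; nia.
rewrite -expnM => lt; rewrite /bitlen.
have := leq_trunc_log 2 (ltnW lt); rewrite trunc_expnK // => le.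
by rewrite (leq_ltn_trans le) //; nia.
Qed.

End Compiler.

(** * The algorithm *)

Declare Scope expr_scope.
Delimit Scope expr_scope with E.
Bind Scope expr_scope with expr.
Notation "x + y" := (Bin Plus x y) : expr_scope.
Notation "x - y" := (Bin Minus x y) : expr_scope.
Notation "x * y" := (Bin Times x y) : expr_scope.
Notation "! x" := (Ref x) (at level 30, right associativity) : expr_scope.
Notation "c1 ;; c2" := (Seq c1 c2) (at level 90, right associativity).
Arguments Cst c%_N.
Arguments Assign i%_N e%_E.
Arguments Update a%_E e%_E.
Arguments Output e%_E.
Arguments When e%_E c.
Arguments For i%_N e%_E c.

Local Notation vn := (Var 0).
Local Notation vi := (Var 1).
Local Notation vj := (Var 2).
Local Notation vk := (Var 3).
Local Notation vN := (Var 4).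
Local Notation vx := (Var 5).
Local Notation va := (Var 7).
Local Notation vb := (Var 8).
Local Notation vma := (Var 9).
Local Notation vmb := (Var 10).
Local Notation vpa := (Var 11).
Local Notation vpb := (Var 12).

(** Positive iff [x = y]. *)
Definition equal (x y : expr) : expr := (Cst 1 - ((x - y) + (y - x)))%E.

Lemma equal_gt0 x y : (0 < 1 - ((x - y) + (y - x))) = (x == y).
Proof. lia. Qed.

(** The numbers after [n] fill the addresses below [N = 3 n^2 + 2 n], kept in variable 4; the labels
    will follow from [N] on. *)
Definition read_cmd : cmd :=
  Input 0;;
  Assign 4 (Cst 3 * (vn * vn) + Cst 2 * vn);;
  For 1 vN (Input 5;; Update vi vx).

(** The minimum starts as the fraction 1/0, which exceeds all others. *)
Definition min_cmd : cmd :=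
  Assign 9 (Cst 1);;
  Assign 10 (Cst 0);;
  For 1 (vn * vn) (
    Assign 7 (! (Cst 3 * vi + Cst 1));;
    Assign 8 (! (Cst 3 * vi + Cst 2));;
    When (! (Cst 3 * vi) * (vma * vb - va * vmb)) (
      Assign 9 va;;
      Assign 10 vb)).

(** The label of [i], kept at address [N + i], is [0] if the threshold of [i]
    differs from the minimum weight. *)
Definition label_cmd : cmd :=
  For 1 vn (
    Assign 7 (! (Cst 3 * (vn * vn) + Cst 2 * vi));;
    Assign 8 (! (Cst 3 * (vn * vn) + Cst 2 * vi + Cst 1));;
    Update (vN + vi) (Cst 0);;
    When (equal (va * vmb) (vma * vb)) (Update (vN + vi) (vi + Cst 1))).

(** Both labels are saved first, because the sweep over [k] overwrites the array it inspects. The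
    product vanishes unless the pair is an edge with both ends labelled. *)
Definition merge_cmd : cmd :=
  For 1 vn (For 2 vn (
    Assign 7 (! (vN + vi));;
    Assign 8 (! (vN + vj));;
    When (va * vb * ! (Cst 3 * (vi * vn + vj)))
      (For 3 vn (
        When (equal (! (vN + vk)) va) (Update (vN + vk) vb))))).

(** Label [i + 1] marks [i] as the representative of its class. As subtraction is truncated, the
    product is positive exactly for edges with [i < j] and both labels zero. *)
Definition output_cmd : cmd :=
  For 1 vn (
    Assign 11 (Cst 0);;
    Assign 12 (Cst 1);;
    When (equal (! (vN + vi)) (vi + Cst 1)) (
      Assign 11 vma;;
      Assign 12 vmb);;
    For 2 vn (
      When ((Cst 1 - ! (vN + vi)) * (Cst 1 - ! (vN + vj)) * (vj - vi)
            * ! (Cst 3 * (vi * vn + vj))) (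
        Assign 7 (! (Cst 3 * (vi * vn + vj) + Cst 1));;
        Assign 8 (! (Cst 3 * (vi * vn + vj) + Cst 2));;
        Assign 11 (vpa * vb + va * vpb);;
        Assign 12 (vpb * vb)));;
    Output vpa;;
    Output vpb).

Definition otvw_cmd : cmd :=
  read_cmd;; min_cmd;; label_cmd;; merge_cmd;; output_cmd.

Lemma wp_for M m i e c (Q : state -> Prop) s (I : nat -> state -> Prop) :
  eval s e <= m -> I 0 s ->
  (forall k s', k < eval s e -> I k s' -> wp M m c (I k.+1) (set_var s' i k)) ->
  (forall s', I (eval s e) s' -> Q s') ->
  wp M m (For i e c) Q s.
Proof. by move=> em I0 IS IQ; split=> //; exists I. Qed.

Lemma wp_seq M m c1 c2 (Q : state -> Prop) s :
  wp M m c1 (wp M m c2 Q) s -> wp M m (c1;; c2) Q s.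
Proof. by []. Qed.

Lemma wp_when M m e c (Q : state -> Prop) s :
  (if 0 < eval s e then wp M m c Q s else Q s) -> wp M m (When e c) Q s.
Proof. by []. Qed.

Lemma pair_lt n i j : i < n -> j < n -> i * n + j < n * n.
Proof. by nia. Qed.

(** * Correctness of the algorithm on words *)

Section Program.

Variables (n : nat) (w : seq nat) (A M m : nat).
Let N := 3 * (n * n) + 2 * n.

(** Pair [q = i * n + j] occupies positions [3 q], [3 q + 1] and [3 q + 2]. *)
Definition flag q := nth 0 w (3 * q).
Definition numer q := nth 0 w (3 * q + 1).
Definition denom q := nth 0 w (3 * q + 2).
Definition tnumer i := nth 0 w (3 * (n * n) + 2 * i).
Definition tdenom i := nth 0 w (3 * (n * n) + 2 * i + 1).

Hypothesis w_le : forall t, nth 0 w t <= A.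
Hypothesis A_gt0 : 0 < A.
Hypothesis m_ge : N <= m.
Hypothesis M_ge : (2 * A) ^ n.+1 <= M.
Hypothesis n_lt : n < M.
Hypothesis denom_gt0 : forall q, q < n * n -> 0 < flag q -> 0 < denom q.

Definition loaded (s : state) : Prop :=
  [/\ var s 0 = n, var s 4 = N & forall t, t < N -> heap s t = nth 0 w t].

Lemma A_le : A <= M.
Proof.
apply: leq_trans M_ge; rewrite expnS -mulnA mulnCA leq_pmulr //.
by rewrite muln_gt0 /= expn_gt0 muln_gt0 A_gt0.
Qed.

Lemma wp_read (Q : state -> Prop) s :
  N <= M -> rest s = n :: w -> written s = [::] ->
  (forall s', loaded s' -> written s' = [::] -> Q s') -> wp M m read_cmd Q s.
Proof.
move=> NM rs ws hQ /=; rewrite rs /= -/N; split=> //.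
split=> //; exists (fun k s' => [/\ var s' 0 = n, var s' 4 = N,
  rest s' = drop k w, written s' = [::] & forall t, t < k -> heap s' t = nth 0 w t]).
split=> //.
- by rewrite drop0.
- move=> k s' kN [vn0 vN0 rs' ws' ms'].
  have E : head 0 (drop k w) = nth 0 w k by rewrite -nth0 nth_drop addn0.
  rewrite /= rs' E; split; first by rewrite (leq_trans (w_le k)) ?A_le.
  split=> //; first by rewrite -drop1 drop_drop add1n.
  move=> t; rewrite ltnS leq_eqVlt; case: eqP => [-> //|_ /=]; exact: ms'.
- by move=> s' [vn0 vN0 rs' ws' ms']; apply: hQ.
Qed.

(** Fractions are compared by cross-multiplication. As denominators of edges are positive, the
    initial value 1/0 meets the last clause only while no edge has been seen. *)
Definition min_spec (k x y : nat) : Prop :=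
  ((x = 1 /\ y = 0) \/
    exists q, [/\ q < k, 0 < flag q, x = numer q & y = denom q]) /\
  (forall q, q < k -> 0 < flag q -> x * denom q <= numer q * y).

Lemma min_spec_step k x y : k < n * n -> min_spec k x y ->
  if 0 < flag k * (x * denom k - numer k * y)
  then min_spec k.+1 (numer k) (denom k) else min_spec k.+1 x y.
Proof.
move=> kn [hxy hmin]; case: ifP => [|/negbT]; rewrite ?muln_gt0 ?subn_gt0.
  case/andP=> fk lt; split; first by right; exists k.
  move=> q; rewrite ltnS leq_eqVlt => /orP[/eqP -> // |qk fq].
  have dq := denom_gt0 (ltn_trans qk kn) fq.
  (* An earlier edge excludes 1/0. Otherwise [y] is positive and can be cancelled, which gives
     transitivity of the comparison. *)
  have := hmin q qk fq; case: hxy => [[x1 y0]|[r [rk fr xr yr]]].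
    by rewrite x1 y0; lia.
  have y0 : 0 < y by rewrite yr denom_gt0 // (ltn_trans rk kn).
  move=> le; rewrite -(leq_pmul2r y0).
  have := leq_mul (ltnW lt) (leqnn (denom q)).
  have := leq_mul (leqnn (denom k)) le; lia.
rewrite negb_and -leqNgt -leqNgt => h; split.
  by case: hxy => [?|[r [rk fr xr yr]]]; [left | right; exists r; rewrite ltnS ltnW].
move=> q; rewrite ltnS leq_eqVlt => /orP[/eqP ->|]; last exact: hmin.
by move: h => /orP[|//]; case: (flag k).
Qed.

Lemma min_spec_le k x y : min_spec k x y -> x <= A /\ y <= A.
Proof. by case=> [[[-> ->]|[q [_ _ -> ->]]] _]; split=> //; apply: w_le. Qed.

Lemma wp_min (Q : state -> Prop) s :
  loaded s -> written s = [::] ->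
  (forall s', loaded s' -> written s' = [::] ->
     min_spec (n * n) (var s' 9) (var s' 10) -> Q s') -> wp M m min_cmd Q s.
Proof.
move=> ls ws hQ; have [vn0 vN0 ms] := ls; split; first by rewrite /=; lia.
split=> //; apply: (@wp_for _ _ _ _ _ _ _ (fun k s' =>
  [/\ loaded s', written s' = [::] & min_spec k (var s' 9) (var s' 10)])).
- by rewrite /= vn0; apply: leq_trans m_ge; rewrite /N; lia.
- by split=> //; split; [left | ].
- move=> k s'; rewrite [eval _ _]/= vn0 => kn [[vn1 vN1 ms'] ws' hs'].
  rewrite /= !ms' /N ?[3 * k + 0]addn0; try lia.
  rewrite -/(numer k) -/(denom k) -/(flag k).
  split; first by rewrite (leq_trans (w_le _)) ?A_le.
  split; first by rewrite (leq_trans (w_le _)) ?A_le.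
  have := min_spec_step kn hs'; case: ifP => _ hs; last by split.
  split; first by rewrite (leq_trans (w_le _)) ?A_le.
  by split; first by rewrite (leq_trans (w_le _)) ?A_le.
- by rewrite [eval _ _]/= vn0 => s' [ls' ws' hs']; apply: hQ.
Qed.

(** * Labels, merging and incentives *)

Section Labels.

Variables x y : nat.
Hypothesis hxy : min_spec (n * n) x y.

(** Equality of the threshold with [x / y]. If [x / y] is still 1/0, it fails for every threshold
    with positive denominator. *)
Definition at_min i := tnumer i * y == x * tdenom i.

Definition labelled (l : nat -> nat) (s : state) : Prop :=
  [/\ loaded s, written s = [::], var s 9 = x, var s 10 = y &
    forall i, i < n -> heap s (N + i) = l i].

Lemma wp_label (Q : state -> Prop) s :
  loaded s -> written s = [::] -> var s 9 = x -> var s 10 = y ->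
  (forall s', labelled (fun i => if at_min i then i.+1 else 0) s' -> Q s') ->
  wp M m label_cmd Q s.
Proof.
move=> ls ws vx vy hQ; have [vn0 vN0 ms] := ls.
apply: (@wp_for _ _ _ _ _ _ _ (fun k s' =>
  [/\ loaded s', written s' = [::], var s' 9 = x, var s' 10 = y &
    forall i, i < k -> heap s' (N + i) = if at_min i then i.+1 else 0])).
- by rewrite /= vn0; apply: leq_trans m_ge; rewrite /N; nia.
- by split.
- move=> k s'; rewrite [eval _ _]/= vn0 => kn [[vn1 vN1 ms'] ws' vx' vy' hs'].
  rewrite /= vn1 vN1 !ms' /N; try lia.
  rewrite -/(tnumer k) -/(tdenom k) -/N.
  split; first by rewrite (leq_trans (w_le _)) ?A_le.
  split; first by rewrite (leq_trans (w_le _)) ?A_le.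
  split=> //; rewrite equal_gt0 vx' vy' -/(at_min k).
  case: ifP => hk; [split; first lia|]; (split=> //; [split=> // t tN /=;
    do 2?[case: eqP => [|_]; first lia]; exact: ms'|]);
    move=> i; rewrite ltnS leq_eqVlt => /orP[/eqP ->|ik] /=;
    rewrite ?eqxx ?hk ?addn1 //; do 2?[case: eqP => [|_]; first lia];
    exact: hs'.
- by rewrite [eval _ _]/= vn0 => s' ?; apply: hQ.
Qed.

(** Every set of vertices that is a union of components of the graph on [T],
    that is, closed under its edges, is also a union of label classes. *)
Definition coarser (T : pred nat) (l : nat -> nat) : Prop :=
  forall S : nat -> Prop,
    (forall i j, i < n -> j < n -> T i -> T j -> 0 < flag (i * n + j) ->
      (S i <-> S j)) ->
    forall i j, i < n -> j < n -> T i -> l i = l j -> (S i <-> S j).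

(** The invariant of merging, where [P] marks the pairs already processed. A nonzero label is one
    more than the index of a vertex carrying it, the representative. [coarser] keeps each class
    inside a component; once all pairs are processed, the last clause makes it a whole one. *)
Definition good (T : pred nat) (P : rel nat) (l : nat -> nat) : Prop :=
  [/\ forall i, i < n -> (0 < l i) = T i,
      forall i, i < n -> T i -> l i <= n /\ l (l i).-1 = l i,
      coarser T l &
      forall i j, i < n -> j < n -> T i -> T j -> 0 < flag (i * n + j) ->
        P i j -> l i = l j].

Lemma good_sub (T : pred nat) (P P' : rel nat) l :
  (forall i j, i < n -> j < n -> T i -> T j -> 0 < flag (i * n + j) ->
     P' i j -> P i j) ->
  good T P l -> good T P' l.
Proof.
by move=> sub [h1 h2 h3 h4]; split=> // i j ni nj Ti Tj f p; apply: h4; auto.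
Qed.

Lemma good_init (T : pred nat) :
  good T (fun _ _ => false) (fun i => if T i then i.+1 else 0).
Proof.
split=> //.
- by move=> i _; case: (T i).
- by move=> i ni Ti; rewrite Ti /= Ti.
- by move=> S _ i j _ _ ->; case: (T j) => // -[->].
Qed.

(** The representative of the class of [j] keeps its label and so represents the union. A set closed
    under edges contains both [i] and [j] or neither, which preserves [coarser]. *)
Lemma good_merge (T : pred nat) P l i j : i < n -> j < n -> T i -> T j ->
  0 < flag (i * n + j) -> good T P l ->
  good T [rel a b | P a b || (a == i) && (b == j)]
    (fun k => if l k == l i then l j else l k).
Proof.
move=> ni nj Ti Tj f [h1 h2 h3 h4]; split.
- by move=> k nk; case: eqP => [e|_]; rewrite h1 // Tj -h1 // e h1.
- move=> k nk Tk; have [lj llj] := h2 j nj Tj; have [lk llk] := h2 k nk Tk.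
  case: eqP => [e|ne]; first by split=> //; rewrite llj; case: eqP.
  by split=> //; rewrite llk; case: eqP ne.
- move=> S hS a b na nb Ta.
  have lS c d := h3 S hS c d; have ij := hS i j ni nj Ti Tj f.
  case: eqP => [ea|ne]; case: eqP => [eb|ne'] e.
  + by apply: lS; rewrite ?ea.
  + by rewrite (lS a i) // ij; apply: lS.
  + by rewrite (lS a j) // -ij; apply: lS; rewrite // -eb.
  + exact: lS.
- move=> a b na nb Ta Tb fab /= /orP[p|/andP[/eqP -> /eqP ->]].
    by rewrite (h4 a b).
  by rewrite eqxx; case: eqP.
Qed.

Lemma wp_merge (Q : state -> Prop) s :
  labelled (fun i => if at_min i then i.+1 else 0) s ->
  (forall s' l, good at_min (fun _ _ => true) l -> labelled l s' -> Q s') ->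
  wp M m merge_cmd Q s.
Proof.
move=> ls hQ; have [[vn0 vN0 ms] _ _ _ _] := ls.
have nm : n <= m by apply: leq_trans m_ge; rewrite /N; nia.
apply: (@wp_for _ _ _ _ _ _ _ (fun k s' => exists2 l,
  good at_min [rel a b | a < k] l & labelled l s')).
- by rewrite /= vn0.
- by eexists; last exact: ls; apply: good_init.
- move=> i s0; rewrite [eval _ _]/= vn0.
  move=> ni [l0 g0 [[vn1 vN1 ms0] ws0 vx0 vy0 hs0]].
  (* Pairs are processed in lexicographic order: the rows before [i], then row [i] up to column
     [k]. *)
  apply: (@wp_for _ _ _ _ _ _ _ (fun k s' => var s' 1 = i /\ exists2 l,
    good at_min [rel a b | (a < i) || (a == i) && (b < k)] l & labelled l s')).
  + by rewrite /= vn1.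
  + split=> //; exists l0; last by split.
    by apply: good_sub g0 => a b _ _ _ _ _ /=; rewrite ltn0 andbF orbF.
  + move=> j s1; rewrite [eval _ _]/= vn1.
    move=> nj [vi1 [l1 g1 [[vn2 vN2 ms1] ws1 vx1 vy1 hs1]]].
    have [h1 h2 h3 h4] := g1.
    have lM k : k < n -> l1 k <= M.
      move=> nk; case: (posnP (l1 k)) => [-> //|p].
      by rewrite h1 // in p; have [le _] := h2 k nk p; lia.
    have q := pair_lt ni nj.
    rewrite /= vN2 vi1 vn2 !hs1 //; split; first exact: lM.
    split; first exact: lM.
    rewrite ms1 -/(flag _); last by rewrite /N; lia.
    rewrite !muln_gt0 h1 // h1 //; case: ifP => [/andP[/andP[Ti Tj] f]|nf].
      split; first by [].
      exists (fun k s' => [/\ var s' 1 = i, var s' 7 = l1 i, var s' 8 = l1 j &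
        labelled (fun a => if (a < k) && (l1 a == l1 i) then l1 j else l1 a) s']).
      split; first by split.
        move=> k s2 nk [vi2 va2 vb2 [[vn3 vN3 ms2] ws2 vx2 vy2 hs2]].
        rewrite /= equal_gt0 vN3 va2 vb2 hs2 // ltnn /=.
        case: eqP => [e|ne]; last first.
          split=> //; split=> // a na /=; rewrite hs2 // ltnS [a <= k]leq_eqVlt.
          by case: (a =P k) => [->|//]; rewrite ltnn /=; case: eqP.
        split; first exact: lM.
        split=> //; split=> //.
          by split=> // t tN /=; case: eqP => [|_]; [lia | apply: ms2].
        move=> a na /=; rewrite eqn_add2l ltnS leq_eqVlt.
        by case: (a =P k) => [->|_]; [rewrite e eqxx | rewrite hs2].
      move=> s2 [vi2 va2 vb2 ls2]; split=> //.
      exists (fun k => if l1 k == l1 i then l1 j else l1 k).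
        apply: good_sub (good_merge ni nj Ti Tj f g1) => a b _ _ _ _ _ /=.
        rewrite ltnS [b <= j]leq_eqVlt.
        by case: (a < i); case: (a == i); case: (b < j); case: (b == j).
      case: ls2 => h5 h6 h7 h8 h9; split=> // a na; rewrite h9 // na //.
    split=> //; exists l1; last by split.
    apply: good_sub g1 => a b na nb Ta Tb fab /=.
    rewrite ltnS [b <= j]leq_eqVlt => /orP[->//|/andP[/eqP ea /orP[/eqP eb|->]]].
      by rewrite -ea -eb Ta Tb fab in nf.
    by rewrite ea eqxx orbT.
  + rewrite [eval _ _]/= vn1 => s1 [_ [l1 g1 ls1]]; exists l1 => //.
    apply: good_sub g1 => a b _ nb _ _ _ /=.
    by rewrite ltnS [a <= i]leq_eqVlt nb andbT orbC.
- rewrite [eval _ _]/= vn0 => s0 [l0 g0 ls0]; apply: hQ ls0.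
  by apply: good_sub g0 => a b na _ _ _ _ /=.
Qed.

(** The incentive of [i], as an unreduced fraction, after [k] rounds of the
    inner loop. *)
Fixpoint incentive (l : nat -> nat) (i k : nat) : nat * nat :=
  if k is j.+1 then
    let: (p, q) := incentive l i j in
    if [&& l i == 0, l j == 0, i < j & 0 < flag (i * n + j)] then
      (p * denom (i * n + j) + numer (i * n + j) * q, q * denom (i * n + j))
    else (p, q)
  else if l i == i.+1 then (x, y) else (0, 1).

Lemma incentiveS l i j : incentive l i j.+1 =
  let: (p, q) := incentive l i j in
  if [&& l i == 0, l j == 0, i < j & 0 < flag (i * n + j)] then
    (p * denom (i * n + j) + numer (i * n + j) * q, q * denom (i * n + j))
  else (p, q).
Proof. by []. Qed.

(** A round multiplies by numbers at most [A] and adds at most two products, so the bound grows by a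
    factor [2 * A]. *)
Lemma incentive_le l i k :
  (incentive l i k).1 <= (2 * A) ^ k.+1 /\ (incentive l i k).2 <= (2 * A) ^ k.+1.
Proof.
elim: k => [|j]; last rewrite incentiveS; rewrite /=.
  have [xA yA] := min_spec_le hxy.
  by rewrite expn1; case: eqP => _ /=; lia.
case: (incentive l i j) => p q /= [hp hq]; rewrite expnS.
have dA : denom (i * n + j) <= A := w_le _.
have uA : numer (i * n + j) <= A := w_le _.
case: ifP => _ /=; last by split; nia.
by split; have := leq_mul hp dA; have := leq_mul hq uA; have := leq_mul hq dA; lia.
Qed.

Lemma wp_output (Q : state -> Prop) s l :
  labelled l s ->
  (forall s', written s' = flatten
     [seq [:: (incentive l i n).1; (incentive l i n).2] | i <- iota 0 n] -> Q s') ->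
  wp M m output_cmd Q s.
Proof.
move=> [[vn0 vN0 ms] ws vx vy hs] hQ.
have nm : n <= m by apply: leq_trans m_ge; rewrite /N; nia.
have le_M l' i k : k <= n ->
    (incentive l' i k).1 <= M /\ (incentive l' i k).2 <= M.
  move=> kn; have [le1 le2] := incentive_le l' i k.
  have le : (2 * A) ^ k.+1 <= M by rewrite (leq_trans _ M_ge) // leq_pexp2l //; lia.
  by rewrite !(leq_trans _ le).
pose kept s' := [/\ loaded s', var s' 9 = x, var s' 10 = y &
  forall i, i < n -> heap s' (N + i) = l i].
apply: (@wp_for _ _ _ _ _ _ _ (fun k s' => kept s' /\ written s' = flatten
  [seq [:: (incentive l i n).1; (incentive l i n).2] | i <- iota 0 k])).
- by rewrite /= vn0.
- by split.
- move=> i s0; rewrite [eval _ _]/= vn0.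
  move=> ni [[[vn1 vN1 ms0] vx0 vy0 hs0] ws0].
  split=> //; split; first by rewrite /=; lia.
  pose J k s' := [/\ kept s', var s' 1 = i,
    written s' = flatten
      [seq [:: (incentive l i n).1; (incentive l i n).2] | i <- iota 0 i] &
    (var s' 11, var s' 12) = incentive l i k].
  (* The precondition of a conditional repeats the remaining code in both branches; here that code
     is treated once for both. *)
  have inner s1 : J 0 s1 -> wp M m (For 2 vn (
      When ((Cst 1 - ! (vN + vi)) * (Cst 1 - ! (vN + vj)) * (vj - vi)
            * ! (Cst 3 * (vi * vn + vj))) (
        Assign 7 (! (Cst 3 * (vi * vn + vj) + Cst 1));;
        Assign 8 (! (Cst 3 * (vi * vn + vj) + Cst 2));;
        Assign 11 (vpa * vb + va * vpb);;
        Assign 12 (vpb * vb)));;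
    Output vpa;;
    Output vpb) (fun s' => kept s' /\ written s' = flatten
      [seq [:: (incentive l i n).1; (incentive l i n).2] | i <- iota 0 i.+1]) s1.
    move=> J0; have [[[vn2 vN2 ms1] vx1 vy1 hs1] _ _ _] := J0.
    apply: wp_seq; apply: (@wp_for _ _ _ _ _ _ _ J) => //.
    - by rewrite /= vn2.
    - move=> j s2; rewrite [eval _ _]/= vn2.
      move=> nj [[[vn3 vN3 ms2] vx2 vy2 hs2] vi2 ws2].
      have q := pair_lt ni nj; have := le_M l i _ (ltnW nj); have := le_M l i _ nj.
      rewrite /J incentiveS; case: (incentive l i j) => a b /=.
      move=> le1 [le2 le3] [pa pb].
      rewrite vN3 vi2 vn3 !hs2 // !ms2 /N; try lia.
      rewrite -/(flag _) -/(numer _) -/(denom _).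
      have -> : (0 < (1 - l i) * (1 - l j) * (j - i) * flag (i * n + j)) =
        [&& l i == 0, l j == 0, i < j & 0 < flag (i * n + j)].
        by rewrite !muln_gt0 !subn_gt0 !ltnS !leqn0 -!andbA.
      case: ifP le1 => [_ /= [le4 le5]|_ _]; last by split=> //; rewrite pa pb.
      split; first by rewrite (leq_trans (w_le _)) ?A_le.
      split; first by rewrite (leq_trans (w_le _)) ?A_le.
      by rewrite pa pb.
    - rewrite [eval _ _]/= vn2 => s2 [[ls2 vx2 vy2 hs2] vi2 ws2 e].
      split=> //; rewrite [LHS]/= ws2 -[i.+1]addn1 iotaD map_cat flatten_cat.
      by rewrite /= add0n -e -!cats1 -catA.
  apply: wp_seq; apply: wp_when.
  rewrite [eval _ _]/= equal_gt0 vN1 hs0 // addn1; case: ifP => li.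
    have [xA yA] := min_spec_le hxy.
    split; first by rewrite /= vx0 (leq_trans xA) ?A_le.
    split; first by rewrite /= vy0 (leq_trans yA) ?A_le.
    by apply: inner; split=> //=; rewrite li vx0 vy0.
  by apply: inner; split=> //=; rewrite li.
- by rewrite [eval _ _]/= vn0 => s' [_ ws']; apply: hQ.
Qed.

End Labels.

Lemma wp_otvw (Q : state -> Prop) s :
  N <= M -> rest s = n :: w -> written s = [::] ->
  (forall s' x y l, min_spec (n * n) x y ->
     good (at_min x y) (fun _ _ => true) l ->
     written s' = flatten [seq [:: (incentive x y l i n).1;
       (incentive x y l i n).2] | i <- iota 0 n] -> Q s') ->
  wp M m otvw_cmd Q s.
Proof.
move=> NM rs ws hQ; apply: (wp_read NM rs ws) => s1 ls1 ws1.
apply: (wp_min ls1 ws1) => s2 ls2 ws2 hxy.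
apply: (wp_label ls2 ws2 erefl erefl) => s3 ls3.
apply: (wp_merge ls3) => s4 l gl ls4.
by apply: (wp_output hxy ls4) => s5 ws5; apply: hQ ws5.
Qed.

End Program.

(** * Optimal target vectors *)

Local Open Scope ring_scope.

(** Both orders of a pair are collected at its smaller member and the nonnegative diagonal is
    dropped. This turns charges made at either end of an edge into a sum over edges. *)
Lemma sum_ordered_pairs_le (R : realType) n (F : 'I_n -> 'I_n -> R) :
  (forall u v, 0 <= F u v) ->
  \sum_(u < n) \sum_(v < n) (if (u < v)%N then F u v + F v u else 0)
    <= \sum_(u < n) \sum_(v < n) F u v.
Proof.
move=> F0.
have -> : \sum_(u < n) \sum_(v < n) (if (u < v)%N then F u v + F v u else 0) =
    \sum_(u < n) \sum_(v < n) ((if (u < v)%N then F u v else 0) +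
                   (if (v < u)%N then F u v else 0)).
  transitivity (\sum_(u < n) \sum_(v < n) (if (u < v)%N then F u v else 0) +
      \sum_(u < n) \sum_(v < n) (if (u < v)%N then F v u else 0)).
    rewrite -big_split; apply: eq_bigr => u _; rewrite -big_split.
    by apply: eq_bigr => v _ /=; case: ifP; rewrite ?addr0.
  rewrite [X in _ + X]exchange_big -big_split; apply: eq_bigr => u _.
  by rewrite -big_split.
apply: ler_sum => u _; apply: ler_sum => v _.
by case: (ltngtP u v) => _; rewrite ?addr0 ?add0r.
Qed.

(** * Edge weights and the activation process *)

Section Graph.

Variables (R : realType) (n : nat) (g : ewgraph R 'I_n).
Local Notation E := (edges (graph g)).

(** The value zero off the edges turns sums over sets of edges into sums over vertices. *)
Definition weight (u v : 'I_n) : R :=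
  if [set u; v] \in E then omega g [set u; v] else 0.

Lemma weight_ge0 u v : 0 <= weight u v.
Proof. by rewrite /weight; case: ifP => // /omega_ge0. Qed.

Lemma weightC u v : weight u v = weight v u.
Proof. by rewrite /weight setUC. Qed.

Lemma edge_neq u v : [set u; v] \in E -> u != v.
Proof. by move/card_edge; rewrite cards2; case: (u == v). Qed.

Lemma weight_diag u : weight u u = 0.
Proof. by rewrite /weight; case: ifP => // /edge_neq; rewrite eqxx. Qed.

(** A neighbour of [x] differs from [x], so it is determined by the edge joining them. *)
Lemma sum_edges_to x (A : {set 'I_n}) :
  \sum_(e in edges_to g x A) omega g e = \sum_(y in A) weight x y.
Proof.
rewrite /weight -big_mkcondr /=.
have -> : edges_to g x A =
    [set [set x; y] | y in [set y in A | [set x; y] \in E]].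
  apply/setP => e; rewrite !inE; apply/andP/imsetP.
    case=> eE /existsP[y /andP[yA /eqP ey]]; exists y => //.
    by rewrite inE yA -ey.
  case=> y; rewrite inE => /andP[yA xyE] ->; split=> //.
  by apply/existsP; exists y; rewrite yA eqxx.
rewrite big_imset /=; first by apply: eq_bigl => y; rewrite inE.
move=> y z; rewrite !inE => /andP[_ /edge_neq xy] /andP[_ _] /setP/(_ y).
by rewrite !inE eqxx orbT eq_sym (negPf xy) /= => /esym/eqP.
Qed.

Lemma sum_incident x : \sum_(e in incident g x) omega g e = \sum_y weight x y.
Proof.
transitivity (\sum_(y in [set: 'I_n]) weight x y); last first.
  by apply: eq_bigl => y; rewrite inE.
rewrite -sum_edges_to; apply: eq_bigl => e; rewrite !inE.
case eE: (e \in E) => //=; apply/idP/existsP.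
  move=> xe; have : #|e :\ x| == 1%N.
    by have := cardsD1 x e; rewrite xe (card_edge eE) add1n => -[<-].
  case/cards1P=> y ey; exists y; rewrite inE /=; apply/eqP.
  by rewrite -(setD1K xe) ey.
by case=> y /andP[_ /eqP ->]; rewrite !inE eqxx.
Qed.

Lemma mu_le e : e \in E -> mu g <= omega g e.
Proof.
rewrite /mu; case: pickP => [e0 e0E|-> //] eE.
by case: (arg_minP (omega g) e0E) => e1 _; apply.
Qed.

Lemma mu_attained e0 : e0 \in E -> exists2 e, e \in E & mu g = omega g e.
Proof.
rewrite /mu; case: pickP => [e1 e1E _|-> //].
by case: (arg_minP (omega g) e1E) => e2 e2E _; exists e2.
Qed.

Lemma mu_ge0 : 0 <= mu g.
Proof.
rewrite /mu; case: pickP => // e0 e0E.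
by case: (arg_minP (omega g) e0E) => e eE _; apply: omega_ge0.
Qed.

Lemma sum_weight_mono x (A B : pred 'I_n) : (forall y, A y -> B y) ->
  \sum_(y | A y) weight x y <= \sum_(y | B y) weight x y.
Proof.
move=> AB; rewrite big_mkcond [leRHS]big_mkcond; apply: ler_sum => y _.
by case: ifP => [/AB -> //|_]; case: ifP; rewrite ?weight_ge0.
Qed.

Lemma active_mono (p : 'I_n -> R) t t' :
  (t <= t')%N -> active g p t \subset active g p t'.
Proof.
move/subnK <-; elim: (t' - t)%N => [//|k IH]; apply: (subset_trans IH).
exact: subsetUl.
Qed.

(** Active sets only grow and vertices are finitely many, so the maximum of the individual rounds
    serves all of them. *)
Lemma active_uniform (p : 'I_n -> R) (A : {set 'I_n}) :
  (forall x, x \in A -> exists t, x \in active g p t) ->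
  exists t, A \subset active g p t.
Proof.
move=> hA; have [|f hf] := @fin_all_exists _ _ (fun x t =>
    x \in A -> x \in active g p t).
  by move=> x; case: (boolP (x \in A)) => [/hA[t xt]|_]; [exists t | exists 0%N].
exists (\max_x f x)%N; apply/subsetP => x /hf; apply/subsetP.
by apply: active_mono; apply: leq_bigmax.
Qed.

Lemma active_step (p : 'I_n -> R) (A : {set 'I_n}) v :
  (forall x, x \in A -> exists t, x \in active g p t) ->
  tau g v <= \sum_(y in A) weight v y + p v ->
  exists t, v \in active g p t.
Proof.
case/active_uniform=> t /subsetP At le; exists t.+1; rewrite !inE /=.
case: (boolP (v \in active g p t)) => //= _.
by rewrite sum_edges_to (le_trans le) // lerD2r sum_weight_mono.
Qed.

(** With [r v] the first round in which [v] is active, the edges that helped to activate [v] lead to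
    vertices with smaller [r]. *)
Lemma target_rounds (q : 'I_n -> R) : target_vector g q ->
  exists r : 'I_n -> nat, forall v,
    tau g v <= \sum_(y | (r y < r v)%N) weight v y + q v.
Proof.
case=> _ [T hT].
have [r hr] : exists r : 'I_n -> nat, forall v,
    v \in active g q (r v) /\ forall t, v \in active g q t -> (r v <= t)%N.
  apply: (@fin_all_exists _ _ (fun v (t : nat) => v \in active g q t /\
    forall t', v \in active g q t' -> (t <= t')%N)) => v.
  have ex : exists t, v \in active g q t by exists T; rewrite hT inE.
  by case: (ex_minnP ex) => t vt ht; exists t.
exists r => v; have [vr hv] := hr v.
(* In round 0 the payment alone suffices. Later, minimality excludes [v] from the active set of
   round [t], so the threshold inequality must hold there. *)
case e: (r v) => [|t] in vr hv *.
  by move: vr; rewrite inE => le; rewrite big_pred0 ?add0r.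
move: vr; rewrite !inE => /orP[/hv|/andP[_]]; first by rewrite ltnn.
move=> le; apply: (le_trans le); rewrite lerD2r sum_edges_to.
by apply: sum_weight_mono => y yt; rewrite ltnS; apply: (hr y).2.
Qed.

(** * The vector paying one vertex per component, and its optimality *)

Section Classes.

Variables (T : pred 'I_n) (rep : 'I_n -> 'I_n).

(** The classes of [rep] are the components of the subgraph induced by [T]. *)
Hypothesis tau_T : forall u, T u -> tau g u = mu g.
Hypothesis tau_notT : forall u, ~~ T u -> tau g u = \sum_v weight u v.
Hypothesis rep_T : forall u, T u -> T (rep u).
Hypothesis rep_rep : forall u, T u -> rep (rep u) = rep u.
Hypothesis rep_edge : forall u v, T u -> T v -> [set u; v] \in E -> rep u = rep v.
Hypothesis rep_reach : forall S : 'I_n -> Prop,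
  (forall u v, T u -> T v -> [set u; v] \in E -> (S u <-> S v)) ->
  forall u, T u -> S (rep u) -> S u.

Definition class_vector (u : 'I_n) : R :=
  if T u then (if rep u == u then mu g else 0)
  else \sum_(v : 'I_n | ~~ T v && (u < v)%N) weight u v.

Lemma class_vector_ge0 u : 0 <= class_vector u.
Proof.
rewrite /class_vector; case: ifP => _; first by case: ifP; rewrite ?mu_ge0.
by apply: sumr_ge0 => v _; apply: weight_ge0.
Qed.

Lemma class_vector_target : target_vector g class_vector.
Proof.
split; first exact: class_vector_ge0.
pose ever v := exists t, v \in active g class_vector t.
have everT u : T u -> ever u.
  move=> Tu; apply: (rep_reach _ Tu); last first.
    exists 0%N; rewrite inE tau_T ?rep_T // /class_vector rep_T // rep_rep //.
    by rewrite eqxx.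
  have half a b : T a -> T b -> [set a; b] \in E -> ever a -> ever b.
    move=> Ta Tb abE [t at_]; apply: (@active_step _ [set a]).
      by move=> x /set1P ->; exists t.
    rewrite big_set1 tau_T // -[mu g]addr0 lerD ?class_vector_ge0 //.
    by rewrite weightC /weight abE mu_le.
  move=> a b Ta Tb abE; split; apply: half => //.
  by rewrite setUC.
have ever_all u : ever u.
  have [k] := ubnP (u : nat); elim: k u => // k IH u uk.
  case: (boolP (T u)) => [/everT //|Tu].
  apply: (@active_step _ [set v | T v || (v < u)%N]).
    move=> v; rewrite inE => /orP[/everT //|vu]; apply: IH.
    by rewrite (leq_trans vu).
  (* Compare with the degree term by term: a neighbour in [T] or before [u] is active, a later one
     outside [T] is paid for, and [u] itself has weight zero. *)
  rewrite tau_notT // /class_vector (negPf Tu) big_mkcond [X in _ + X]big_mkcond.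
  rewrite [X in X + _]big_mkcond -big_split /=; apply: ler_sum => v _.
  rewrite inE; case: (T v) => /=; first by rewrite addr0.
  case: (ltngtP v u) => [_|_|/ord_inj ->]; rewrite ?addr0 ?add0r //.
  by rewrite weight_diag.
have [t /subsetP ht] : exists t, [set: 'I_n] \subset active g class_vector t.
  by apply: active_uniform => x _; apply: ever_all.
by exists t; apply/setP => x; rewrite inE ht ?inE.
Qed.

(** The vertex of a class that is activated first is paid for itself, or some
    earlier neighbour outside [T] was paid for the edge between them. *)
Lemma class_sum_ge (q : 'I_n -> R) (r : 'I_n -> nat) c :
  (forall v, 0 <= q v) ->
  (forall v, tau g v <= \sum_(y | (r y < r v)%N) weight v y + q v) ->
  T c -> rep c = c ->
  mu g <= \sum_(x | T x && (rep x == c))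
    (q x + \sum_(v | ~~ T v && (r v <= r x)%N) weight v x).
Proof.
move=> q0 hr Tc rc.
have Pc : T c && (rep c == c) by rewrite Tc rc eqxx.
case: (@arg_minnP _ c (fun x => T x && (rep x == c)) r Pc) => d /andP[Td /eqP rd] hd.
have s0 x : 0 <= \sum_(v | ~~ T v && (r v <= r x)%N) weight v x.
  by apply: sumr_ge0 => v _; apply: weight_ge0.
rewrite (bigD1 d) ?Td ?rd ?eqxx //=.
rewrite -[mu g]addr0 lerD //; last by apply: sumr_ge0 => x _; rewrite addr_ge0.
(* An earlier neighbour of [d] in [T] would lie in the same class, against the choice of [d].
   Without any earlier neighbour, [q d] alone must reach the threshold [mu]. *)
case: (pickP (fun x => ([set d; x] \in E) && (r x < r d)%N)) => [x|none].
  case/andP=> dxE rx; have Tx : ~~ T x.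
    apply/negP => Tx; have := hd x; rewrite Tx -(rep_edge Td Tx dxE) rd eqxx.
    by move=> /(_ isT); rewrite leqNgt rx.
  rewrite (bigD1 x) /=; last by rewrite Tx ltnW.
  rewrite addrCA -[mu g]addr0 lerD //.
    by rewrite weightC /weight dxE mu_le.
  by rewrite addr_ge0 //; apply: sumr_ge0 => v _; apply: weight_ge0.
rewrite -(tau_T Td) (le_trans (hr d)) // big1 ?add0r ?lerDl //.
by move=> y ry; rewrite /weight; have := none y; rewrite ry andbT => ->.
Qed.

Lemma class_vector_optimal : optimal_target_vector g class_vector.
Proof.
split; first exact: class_vector_target.
move=> q tq; have [r hr] := target_rounds tq; have [q0 _] := tq.
rewrite (bigID T) [X in _ <= X](bigID T) /=.
(* The threshold of [v] is its whole degree, so [q v] covers all edges to vertices not activated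
   strictly before [v]. *)
have lowD v : ~~ T v ->
    \sum_(x | T x && (r v <= r x)%N) weight v x +
    \sum_(x | ~~ T x && (r v <= r x)%N) weight v x <= q v.
  move=> Tv; have := hr v; rewrite tau_notT //.
  rewrite (bigID (fun y => r y < r v)%N) /= lerD2l.
  rewrite (bigID T) /=; apply: le_trans; rewrite lerD //.
    by apply: sum_weight_mono => x; rewrite -leqNgt andbC.
  by apply: sum_weight_mono => x; rewrite -leqNgt andbC.
(* What is paid outside [T] for edges into [T] is credited to their ends in [T]; the rest goes to
   edges with both ends outside. *)
apply: (@le_trans _ _ (\sum_(x | T x)
    (q x + \sum_(v | ~~ T v && (r v <= r x)%N) weight v x)
  + \sum_(v | ~~ T v) \sum_(x | ~~ T x && (r v <= r x)%N) weight v x)); last first.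
  rewrite big_split /= -addrA lerD2l.
  have -> : \sum_(x | T x) \sum_(v | ~~ T v && (r v <= r x)%N) weight v x =
      \sum_(v | ~~ T v) \sum_(x | T x && (r v <= r x)%N) weight v x.
    rewrite (exchange_big_dep (fun v => ~~ T v)) /=; last by move=> x v _ /andP[].
    by apply: eq_bigr => v Tv; apply: eq_bigl => x; rewrite Tv.
  by rewrite -big_split; apply: ler_sum => v /lowD.
apply: lerD.
  rewrite [leRHS](partition_big rep (fun c => T c && (rep c == c))) /=.
    2: by move=> x Tx; rewrite rep_T ?rep_rep ?eqxx.
  rewrite /class_vector (bigID (fun c => rep c == c)) /= [X in _ + X]big1 ?addr0.
    apply: ler_sum => c /andP[Tc /eqP rc]; rewrite Tc rc eqxx.
    exact: class_sum_ge.
  by move=> c /andP[Tc /negPf rc]; rewrite Tc rc.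
(* [F v x] is the weight charged to [v] for its edge to [x]. One of two vertices is activated no
   later than the other, so each edge outside [T] is charged at least once. *)
pose F v x : R := if [&& ~~ T v, ~~ T x & (r v <= r x)%N] then weight v x else 0.
have F0 v x : 0 <= F v x by rewrite /F; case: ifP; rewrite ?weight_ge0.
have -> : \sum_(v | ~~ T v) \sum_(x | ~~ T x && (r v <= r x)%N) weight v x =
    \sum_v \sum_x F v x.
  rewrite big_mkcond; apply: eq_bigr => v _; rewrite /F.
  by case: ifP => _ /=; [rewrite big_mkcond | rewrite big1].
apply: le_trans (sum_ordered_pairs_le F0).
rewrite big_mkcond; apply: ler_sum => v _; rewrite /class_vector /F.
case: (T v) => /=.
  by apply: sumr_ge0 => x _; case: ifP => // _; rewrite andbF add0r.
rewrite big_mkcond; apply: ler_sum => x _; case: (T x) => /=.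
  by case: ifP; rewrite ?addr0.
case: ifP => // _; rewrite [weight x v]weightC.
case: (leqP (r v) (r x)) => [_|/ltnW ->]; last by rewrite add0r.
by rewrite lerDl; case: ifP; rewrite ?weight_ge0.
Qed.

End Classes.

End Graph.

(** * Reading the input and writing the output *)

Local Open Scope nat_scope.

Lemma size_flatten_const (T : Type) c (ss : seq (seq T)) :
  all (fun s => size s == c) ss -> size (flatten ss) = c * size ss.
Proof.
elim: ss => [|s ss IH] /=; first by rewrite muln0.
by case/andP=> /eqP hs /IH e; rewrite size_cat hs e mulnS.
Qed.

Lemma nth_flatten_const (T : Type) (x0 : T) c (ss : seq (seq T)) q r :
  all (fun s => size s == c) ss -> q < size ss -> r < c ->
  nth x0 (flatten ss) (c * q + r) = nth x0 (nth [::] ss q) r.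
Proof.
elim: ss q => [|s ss IH] [|q] //= /andP[/eqP hs hss] hq hr.
  by rewrite muln0 add0n nth_cat hs hr.
by rewrite nth_cat hs mulnS -addnA ltnNge leq_addr addKn /= IH.
Qed.

Lemma input_size_ge (u : seq nat) : size u <= input_size u.
Proof. by rewrite -sum1_size; apply: leq_sum. Qed.

Lemma input_lt (u : seq nat) x : x \in u -> x < 2 ^ input_size u.
Proof.
move=> xu; have lt : x < 2 ^ bitlen x by apply: trunc_log_ltn.
apply: (leq_trans lt); rewrite leq_pexp2l // /input_size.
by rewrite (big_rem x) //= leq_addr.
Qed.

(** * Decoding the input word *)

Section Instance.

Variables (R : realType) (n : nat) (g : ewgraph R 'I_n).
Variables (wa wb : {set 'I_n} -> nat) (ta tb : 'I_n -> nat).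
Local Notation E := (edges (graph g)).

Definition entry (i j : 'I_n) : seq nat :=
  let e := [set i; j] in
  if e \in E then [:: 1; wa e; wb e] else [:: 0; 0; 0].

Definition entries : seq (seq nat) :=
  [seq entry i j | i <- enum 'I_n, j <- enum 'I_n].

Definition thresholds : seq (seq nat) := [seq [:: ta i; tb i] | i <- enum 'I_n].

Definition word : seq nat := flatten entries ++ flatten thresholds.

Hypothesis omega_frac : forall e, e \in E -> is_fraction (omega g e) (wa e) (wb e).
Hypothesis tau_frac : forall i, is_fraction (tau g i) (ta i) (tb i).
Hypothesis tau_min_or_degree : forall u,
  tau g u = (\sum_(e in incident g u) omega g e)%R \/ tau g u = mu g.

Lemma entries_size3 : all (fun s => size s == 3) entries.
Proof.
apply/allP => s /allpairsP[[i j] /= [_ _ ->]].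
by rewrite /entry; case: ifP.
Qed.

Lemma thresholds_size2 : all (fun s => size s == 2) thresholds.
Proof. by apply/allP => s /mapP[i _ ->]. Qed.

Lemma size_entries : size entries = n * n.
Proof. by rewrite size_allpairs -cardE card_ord. Qed.

Lemma size_entries_flat : size (flatten entries) = 3 * (n * n).
Proof. by rewrite (size_flatten_const entries_size3) size_entries. Qed.

Lemma size_word : size word = 3 * (n * n) + 2 * n.
Proof.
rewrite size_cat size_entries_flat (size_flatten_const thresholds_size2).
by rewrite size_map -cardE card_ord.
Qed.

(** [entries] is itself a concatenation of [n] rows of length [n], so block indexing applies to it
    as well. *)
Lemma nth_entries (i j : 'I_n) : nth [::] entries (i * n + j) = entry i j.
Proof.
rewrite /entries /allpairs mulnC (@nth_flatten_const _ _ n) //.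
- rewrite (nth_map i) -?cardE ?card_ord // nth_ord_enum.
  by rewrite (nth_map j) -?cardE ?card_ord // nth_ord_enum.
- by apply/allP => s /mapP[k _ ->]; rewrite size_map -cardE card_ord.
- by rewrite size_map -cardE card_ord.
Qed.

Lemma nth_word (i j : 'I_n) r :
  r < 3 -> nth 0 word (3 * (i * n + j) + r) = nth 0 (entry i j) r.
Proof.
move=> r3; have lt := pair_lt (ltn_ord i) (ltn_ord j).
rewrite nth_cat size_entries_flat ifT; last lia.
by rewrite (nth_flatten_const _ entries_size3) ?size_entries // nth_entries.
Qed.

Lemma flag_word (i j : 'I_n) :
  (0 < flag word (i * n + j)) = ([set i; j] \in E).
Proof. by rewrite /flag -[3 * _]addn0 nth_word // /entry; case: ifP. Qed.

Lemma numer_word (i j : 'I_n) :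
  [set i; j] \in E -> numer word (i * n + j) = wa [set i; j].
Proof. by rewrite /numer nth_word // /entry => ->. Qed.

Lemma denom_word (i j : 'I_n) :
  [set i; j] \in E -> denom word (i * n + j) = wb [set i; j].
Proof. by rewrite /denom nth_word // /entry => ->. Qed.

Lemma tnumer_word (i : 'I_n) : tnumer n word i = ta i.
Proof.
rewrite /tnumer nth_cat size_entries_flat ifF; last lia.
rewrite addKn -[2 * i]addn0 (nth_flatten_const _ thresholds_size2) //.
  by rewrite (nth_map i) -?cardE ?card_ord // nth_ord_enum.
by rewrite size_map -cardE card_ord.
Qed.

Lemma tdenom_word (i : 'I_n) : tdenom n word i = tb i.
Proof.
rewrite /tdenom nth_cat size_entries_flat ifF; last lia.
rewrite -addnA addKn (nth_flatten_const _ thresholds_size2) //.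
  by rewrite (nth_map i) -?cardE ?card_ord // nth_ord_enum.
by rewrite size_map -cardE card_ord.
Qed.

Lemma pair_index q : q < n * n -> exists i j : 'I_n, q = i * n + j.
Proof.
move=> lt; have n0 : 0 < n by case: n lt.
have iP : q %/ n < n by rewrite ltn_divLR.
by exists (Ordinal iP), (Ordinal (ltn_pmod q n0)); rewrite /= -divn_eq.
Qed.

Lemma denom_word_gt0 q : q < n * n -> 0 < flag word q -> 0 < denom word q.
Proof.
case/pair_index=> i [j ->]; rewrite flag_word => ijE.
by rewrite denom_word //; case: (omega_frac ijE).
Qed.

Lemma edge_index e : e \in E -> exists i j : 'I_n, e = [set i; j].
Proof. by move/card_edge/eqP/cards2P=> [i [j [_ ->]]]; exists i, j. Qed.

Local Open Scope ring_scope.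

Lemma le_fraction (a b c d : nat) : (0 < b)%N -> (0 < d)%N ->
  (a%:R / b%:R <= c%:R / d%:R :> R) = (a * d <= c * b)%N.
Proof.
move=> b0 d0; rewrite ler_pdivrMr ?ltr0n // mulrAC ler_pdivlMr ?ltr0n //.
by rewrite -!natrM ler_nat.
Qed.

Lemma eq_fraction (a b c d : nat) : (0 < b)%N -> (0 < d)%N ->
  (a%:R / b%:R == c%:R / d%:R :> R) = (a * d == c * b)%N.
Proof. by move=> b0 d0; rewrite eq_le !le_fraction // eqn_leq. Qed.

(** * The computed fractions form an optimal target vector *)

Section Minimum.

Variables x y : nat.
Hypothesis hxy : min_spec word (n * n)%N x y.

(** Every edge occurs among the pairs, so an attained minimum is [mu], and 1/0 survives only in an
    edgeless graph. *)
Lemma min_spec_mu :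
  [/\ x = 1%N, y = 0%N & E = set0] \/ (0 < y)%N /\ mu g = x%:R / y%:R.
Proof.
case: hxy => hex hmin; case: hex => [[x1 y0]|[q [qn fq xq yq]]].
  left; split=> //; apply/setP => e; rewrite inE; apply/negP => eE.
  have [i [j eij]] := edge_index eE; rewrite eij in eE.
  have fij : (0 < flag word (i * n + j))%N by rewrite flag_word.
  have := hmin _ (pair_lt (ltn_ord i) (ltn_ord j)) fij.
  have := denom_word_gt0 (pair_lt (ltn_ord i) (ltn_ord j)) fij.
  by rewrite x1 y0; lia.
have y0 : (0 < y)%N by rewrite yq denom_word_gt0.
right; split=> //.
have [i [j qij]] := pair_index qn; rewrite qij in qn fq xq yq.
rewrite flag_word in fq; rewrite numer_word // in xq; rewrite denom_word // in yq.
have wxy : omega g [set i; j] = x%:R / y%:R by rewrite xq yq; case: (omega_frac fq).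
apply/eqP; rewrite eq_le -{1}wxy mu_le //=.
have [e eE ->] := mu_attained fq; have [a [b eab]] := edge_index eE.
rewrite eab in eE *; have [b0 ->] := omega_frac eE.
rewrite le_fraction // -numer_word // -denom_word //.
by apply: hmin; rewrite ?pair_lt // flag_word.
Qed.

Local Notation T := (fun i : 'I_n => at_min n word x y i).

(** Without edges the hypothesis equates a positive denominator with zero, so that case is void. *)
Lemma tau_at_min i : T i -> tau g i = mu g.
Proof.
rewrite /at_min tnumer_word tdenom_word; have [b0 ->] := tau_frac i.
case: min_spec_mu => [[-> -> _]|[y0 ->]]; first by lia.
by move=> ?; apply/eqP; rewrite eq_fraction.
Qed.

(** A threshold [mu] can fail the test only in an edgeless graph, where [mu] and the degree are both
    zero. *)
Lemma tau_not_at_min i : ~~ T i -> tau g i = \sum_v weight g i v.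
Proof.
move=> Ti; rewrite -sum_incident; case: (tau_min_or_degree i) => // ei.
case: min_spec_mu => [[_ _ E0]|[y0 emu]].
  rewrite ei /mu E0; case: pickP => [e|_]; first by rewrite inE.
  by rewrite big_pred0 // => e; rewrite inE E0 inE.
case/negP: Ti; rewrite /at_min tnumer_word tdenom_word.
by have [b0 e] := tau_frac i; rewrite -eq_fraction // -e ei emu.
Qed.

Variable l : nat -> nat.
Hypothesis hl : good n word (at_min n word x y) (fun _ _ => true) l.

(** Labels on [T] lie between 1 and [n], so the default of [insubd] is not reached there. *)
Definition root (i : 'I_n) : 'I_n := insubd i (l i).-1.

Lemma label_eq0 (i : 'I_n) : (l i == 0%N) = ~~ T i.
Proof. by case: hl => h1 _ _ _; rewrite -h1 // lt0n negbK. Qed.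

Lemma val_root i : T i -> (root i).+1 = l i.
Proof.
case: hl => h1 h2 _ _ Ti; have [le _] := h2 i (ltn_ord i) Ti.
have := h1 i (ltn_ord i); rewrite Ti => p.
by rewrite val_insubd ifT; lia.
Qed.

Lemma label_root i : T i -> l (root i) = l i.
Proof.
move=> Ti; case: hl => _ h2 _ _; have [_] := h2 i (ltn_ord i) Ti.
by rewrite -(val_root Ti).
Qed.

Lemma root_at_min i : T i -> T (root i).
Proof.
move=> Ti; have := label_eq0 (root i); rewrite label_root // label_eq0 Ti.
by move/esym/negbFE.
Qed.

Lemma root_eq i j : T i -> T j -> l i = l j -> root i = root j.
Proof.
by move=> Ti Tj e; apply/ord_inj/succn_inj; rewrite !val_root.
Qed.

Lemma class_vector_root_optimal :
  optimal_target_vector g (class_vector g T root).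
Proof.
apply: class_vector_optimal.
- exact: tau_at_min.
- exact: tau_not_at_min.
- exact: root_at_min.
- by move=> i Ti; apply: root_eq; rewrite ?root_at_min ?label_root.
- move=> i j Ti Tj ijE; apply: root_eq => //; case: hl => _ _ _ h4.
  by apply: h4; rewrite ?flag_word.
- move=> S hS i Ti; case: hl => _ _ h3 _.
  (* [coarser] quantifies over predicates on [nat], so [S] is carried over along the inclusion of
     ['I_n]. *)
  pose S' a := exists2 b : 'I_n, b = a :> nat & S b.
  have S'P (b : 'I_n) : S' b <-> S b.
    by split=> [[c /ord_inj -> //]|Sb]; exists b.
  have iff : S' (root i) <-> S' i.
    apply: h3; rewrite ?root_at_min ?label_root //.
    move=> a b na nb Ta Tb fab.
    have := hS (Ordinal na) (Ordinal nb) Ta Tb; rewrite -flag_word => /(_ fab).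
    by rewrite -(S'P (Ordinal na)) -(S'P (Ordinal nb)).
  by rewrite -!S'P => /iff.
Qed.

Local Notation incentive_at := (incentive n word x y l).

Lemma incentive_at_min (i : 'I_n) k : T i ->
  incentive_at i k = if l i == i.+1 then (x, y) else (0%N, 1%N).
Proof.
move=> Ti; elim: k => [//|k IH]; rewrite incentiveS IH.
by rewrite label_eq0 Ti; case: ifP.
Qed.

Lemma sum_below_step (F : 'I_n -> R) k (kn : (k < n)%N) :
  \sum_(v < n | (v < k.+1)%N) F v = \sum_(v < n | (v < k)%N) F v + F (Ordinal kn).
Proof.
rewrite (bigD1 (Ordinal kn)) //= addrC; congr (_ + _); apply: eq_bigl => v.
by rewrite -val_eqE /= ltnS ltn_neqAle andbC.
Qed.

(** Partial sums are used so that each round of [incentive] accounts for one term. *)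
Lemma incentive_not_at_min (i : 'I_n) k : (k <= n)%N -> ~~ T i ->
  is_fraction (\sum_(v < n | (v < k)%N)
      if ~~ T v && (i < v)%N then weight g i v else 0)
    (incentive_at i k).1 (incentive_at i k).2.
Proof.
move=> + Ti; elim: k => [_|k IH kn].
  rewrite big_pred0 //= ; move: (label_eq0 i); rewrite Ti => /eqP ->.
  by split; rewrite ?mul0r.
rewrite sum_below_step incentiveS; have [] := IH (ltnW kn).
case: (incentive_at i k) => p q /= q0 ->.
have := label_eq0 i; rewrite Ti => -> /=.
have := label_eq0 (Ordinal kn) => /= ->.
case: (at_min n word x y k) => /=; first by rewrite addr0.
case: ltnP => _ /=; last by rewrite addr0.
have := flag_word i (Ordinal kn) => /= ->.
rewrite /weight; case: ifP => [ikE|_] /=; last by rewrite addr0.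
have := numer_word ikE; have := denom_word ikE => /= -> ->.
have [b0 ->] := omega_frac ikE; split=> /=; first by rewrite muln_gt0 q0.
by rewrite natrD !natrM addf_div // pnatr_eq0 -lt0n.
Qed.

Lemma class_vector_fraction (i : 'I_n) :
  is_fraction (class_vector g T root i) (incentive_at i n).1 (incentive_at i n).2.
Proof.
rewrite /class_vector; case: (boolP (T i)) => Ti.
  rewrite incentive_at_min // -val_root // eqSS -val_eqE.
  case: ifP => _; last by split; rewrite ?mul0r.
  (* A representative in [T] excludes 1/0, so the fraction written has a positive denominator. *)
  case: min_spec_mu => [[x1 y0 _]|[y0 ->]]; last by split.
  move: Ti; rewrite /at_min tdenom_word x1 y0.
  by have [b0 _] := tau_frac i; lia.
have := incentive_not_at_min (leqnn n) Ti.
congr is_fraction; rewrite -big_mkcondr; apply: eq_bigl => v.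
by rewrite ltn_ord.
Qed.

End Minimum.
End Instance.

(** * Running time and conclusion *)

Local Open Scope ring_scope.

(** Speaking of words alone, this fixes the program and the constants before any graph is given. *)
Lemma otvw_polytime : exists P c k, forall (n : nat) (w u : seq nat),
  u = n :: w -> size w = (3 * (n * n) + 2 * n)%N ->
  (forall q, q < n * n -> 0 < flag w q -> 0 < denom w q)%N ->
  exists v t, [/\ computes_in P u v t, (t <= c * (input_size u).+1 ^ k)%N &
    exists x y l, [/\ min_spec w (n * n) x y,
      good n w (at_min n w x y) (fun _ _ => true) l &
      v = flatten [seq [:: (incentive n w x y l i n).1;
        (incentive n w x y l i n).2] | i <- iota 0 n]]].
Proof.
(* Variables 0 to 12 take 13 registers; the temporaries fit below register 40, where the memory
   starts. *)
have [a [k ha]] := step_bound_poly 40 otvw_cmd.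
have [b hb] := bitlen_bound 40 otvw_cmd.
exists (compile 40 13 0 otvw_cmd), (a * (2 * b))%N, (k + 2)%N => n w u eu sw dw.
(* Inputs are below [2 ^ S] and [n < S], so the unreduced fractions are bounded by
   [(2 * 2 ^ S) ^ n.+1 <= 2 ^ x]. *)
set S := input_size u; pose x := (S.+1 ^ 2)%N.
have uS : (size u <= S)%N := input_size_ge u.
have wS : (size w < S)%N by rewrite eu in uS.
have nS : (n < S)%N by nia.
have S2 : (S < 2 ^ S)%N by apply: ltn_expl.
have Sx : (2 ^ S <= 2 ^ x)%N by rewrite leq_pexp2l // /x; nia.
have uM y : y \in u -> (y <= 2 ^ x)%N.
  by move=> yu; rewrite (leq_trans _ Sx) // ltnW // input_lt.
have wA i : (nth 0 w i <= 2 ^ S)%N.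
  case: (ltnP i (size w)) => [iw|iw]; last by rewrite nth_default.
  by rewrite ltnW // input_lt // eu inE mem_nth ?orbT.
have [||s [t [ct tt [x0 [y0 [l hQ]]]]]] :=
  @compile_correct 13 40 otvw_cmd (2 ^ x) S u
  (fun s => exists x y l, [/\ min_spec w (n * n) x y,
      good n w (at_min n w x y) (fun _ _ => true) l &
      written s = flatten [seq [:: (incentive n w x y l i n).1;
        (incentive n w x y l i n).2] | i <- iota 0 n]]) isT isT _ uM.
- by rewrite (leq_trans _ Sx) // ltnW.
- apply: (@wp_otvw n w (2 ^ S) (2 ^ x) S wA) => //.
  + by rewrite expn_gt0.
  + by rewrite -sw ltnW.
  + rewrite -expnS -expnM leq_pexp2l // /x expnS expn1 leq_mul2l orbC ltnW //.
  + lia.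
  + by rewrite -sw; lia.
  + by move=> s x1 y1 l h1 h2 h3; exists x1, y1, l.
exists (written s), t; split=> //; last by exists x0, y0, l.
(* The number of steps has degree [k] in [S.+1], and the cost of a step is linear in [x], which adds
   2 to the exponent. *)
have := ha S; have := hb x; rewrite {1}/x expn_gt0 => /(_ isT) h1 h2.
apply: (leq_trans tt); apply: (leq_trans (leq_mul h2 (leq_mul (leqnn 2) h1))).
by rewrite expnD -/x; lia.
Qed.

Theorem theorem3p5 (R : realType) :
  polytime_solvable
    (restrict (Q := OTVW R) (fun x : {n : nat & ewgraph R 'I_n} =>
       let g := projT2 x in
       forall u, tau g u = \sum_(e in incident g u) omega g e \/
                 tau g u = mu g)).
Proof.
have [P [c [k hP]]] := otvw_polytime; exists P, c, k.
move=> [[n g] /= hg] u /= [wa [wb [ta [tb [homega htau eu]]]]].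
have sw := size_word g wa wb ta tb.
have dw := @denom_word_gt0 R n g wa wb ta tb homega.
have [v [t [ct tt [x [y [l [hxy hl ev]]]]]]] := hP n (word g wa wb ta tb) u eu sw dw.
exists v, t; split=> //.
exists (class_vector g (at_min n (word g wa wb ta tb) x y) (root l)).
  by have := class_vector_root_optimal homega htau hg hxy hl.
exists (fun i => (incentive n (word g wa wb ta tb) x y l i n).1).
exists (fun i => (incentive n (word g wa wb ta tb) x y l i n).2).
split; first by move=> i; apply: (class_vector_fraction homega htau hxy hl).
by rewrite ev -val_enum_ord -map_comp.
Qed.
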